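(* Let $n\ge2$ and let $k\ge 1$ be an integer. The bounded linear trace operator $$\mathrm{tr}_k\colon\dot W^{k,1}(\mathbb{R}^n_+)\to\mathrm{tr}_k(\dot W^{k,1}(\mathbb{R}^n_+))=\mathrm{T}_k(\mathbb{R}^{n-1})$$ does not admit a right inverse that is both linear and continuous.
   Context: $\mathbb{R}^n_+=\{x=(x',x_n):x_n>0\}$ and $\mathbb{R}^{n-1}\simeq\mathbb{R}^{n-1}\times\{0\}=\partial\mathbb{R}^n_+$. Functions are scalar (real) valued. $\dot W^{k,1}(\mathbb{R}^n_+)$ is the homogeneous Sobolev space normed by $\|D^ku\|_{L^1(\mathbb{R}^n_+)}$, understood as the completion in this norm of the restrictions to $\mathbb{R}^n_+$ of functions in $C_c^\infty(\mathbb{R}^n)$. For $s>0$ and any integer $m>s$, the homogeneous Besov norm is $$\|f\|_{\dot{B}^{s}_{1,1}(\mathbb{R}^{n-1})}=\int_{\mathbb{R}^{n-1}}\int_{\mathbb{R}^{n-1}}|\Delta_h^m f(x)|\,dx\,\frac{dh}{|h|^{n-1+s}},\qquad \Delta_h^m f(x)=\sum_{i=0}^m(-1)^{m-i}\binom{m}{i}f(x+ih),$$ different choices of $m$ giving equivalent norms; $\dot B^s_{1,1}(\mathbb{R}^{n-1})$ is the corresponding homogeneous Besov space, understood as the completion of $C_c^\infty(\mathbb{R}^{n-1})$ in this norm. $\mathrm{T}_k(\mathbb{R}^{n-1})$ is the Banach space of tuples $(f_0,\ldots,f_{k-1})$ with $f_{k-1}\in L^1(\mathbb{R}^{n-1})$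 and $f_j\in\dot B^{k-1-j}_{1,1}(\mathbb{R}^{n-1})$ for $0\le j\le k-2$, with norm $\sum_{j=0}^{k-2}\|f_j\|_{\dot B^{k-1-j}_{1,1}}+\|f_{k-1}\|_{L^1}$. The trace operator is $\mathrm{tr}_ku=(u,\partial_nu,\ldots,\partial_n^{k-1}u)|_{\mathbb{R}^{n-1}}$ for $u\in C_c^\infty(\mathbb{R}^n)$, extended to $\dot W^{k,1}(\mathbb{R}^n_+)$ by continuity, using the inequality $\|\mathrm{tr}_ku\|_{\mathrm{T}_k(\mathbb{R}^{n-1})}\le c\|D^ku\|_{L^1(\mathbb{R}^n_+)}$ for $u\in C_c^\infty(\mathbb{R}^n)$. A right inverse is a map $E:\mathrm{T}_k(\mathbb{R}^{n-1})\to\dot W^{k,1}(\mathbb{R}^n_+)$ with $\mathrm{tr}_k\circ E=\mathrm{id}$. *)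

(* Defs.v *)
From HB Require Import structures.
From mathcomp Require Import all_boot all_order all_algebra.
From mathcomp Require Import all_classical all_reals all_analysis.
From mathcomp Require Import measurable_realfun.
Set Implicit Arguments.
Unset Strict Implicit.
Unset Printing Implicit Defensive.
Import Order.TTheory GRing.Theory Num.Theory.
Import numFieldNormedType.Exports.
Local Open Scope classical_set_scope.
Local Open Scope ring_scope.

(* Row vectors carry the product of the Borel sigma-algebras of R. *)
Section rV_measurable.
Context (R : realType) (n : nat).
Let coord (i : 'I_n) (x : 'rV[R]_n) : measurableTypeR R := x 0 i.

Let rV_set0 : g_sigma_preimage coord set0.
Proof. exact: sigma_algebra0. Qed.

Let rV_setC A : g_sigma_preimage coord A -> g_sigma_preimage coord (~` A).
Proof. exact: sigma_algebraC. Qed.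

Let rV_bigcup (F : _^nat) : (forall i, g_sigma_preimage coord (F i)) ->
  g_sigma_preimage coord (\bigcup_i (F i)).
Proof. exact: sigma_algebra_bigcup. Qed.

HB.instance Definition _ := @isMeasurable.Build
  (measure_tuple_display (R.-ocitv.-measurable).-sigma)
  'rV[R]_n (g_sigma_preimage coord) rV_set0 rV_setC rV_bigcup.

Lemma measurable_coord (i : 'I_n) :
  measurable_fun [set: 'rV[R]_n] (fun x => x 0 i : measurableTypeR R).
Proof.
move=> _ Y mY; rewrite setTI; apply: sub_sigma_algebra => /=.
rewrite -bigcup_seq/=; exists i => /=; first by rewrite mem_index_enum.
by exists Y => //; rewrite setTI.
Qed.

Lemma measurable_fun_rVP d (T : measurableType d) (f : T -> 'rV[R]_n) :
  (forall i, measurable_fun setT (fun t => f t 0 i : measurableTypeR R)) ->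
  measurable_fun setT f.
Proof.
move=> mf _ A mA; rewrite setTI.
suff : g_sigma_preimage coord `<=` [set B | measurable (f @^-1` B)] by exact.
apply: smallest_sub.
  split=> /=; first by rewrite preimage_set0.
  - by move=> B mB; rewrite setTD preimage_setC; exact: measurableC.
  - by move=> F mF; rewrite preimage_bigcup; exact: bigcup_measurable.
move=> B /=; rewrite -bigcup_seq => -[i _ [C mC <-]] /=.
by rewrite setTI; have := mf i measurableT C mC; rewrite setTI.
Qed.

End rV_measurable.

(* The library's instance for this fact is restricted to subprobabilities. *)
Lemma product_sigma_finite d1 d2 (T1 : measurableType d1)
    (T2 : measurableType d2) (R : realType)
    (m1 : {sigma_finite_measure set T1 -> \bar R})
    (m2 : {sigma_finite_measure set T2 -> \bar R}) :
  sigma_finite setT (m1 \x m2)%E.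
Proof.
have /sigma_finiteP[F [TF ndF Foo]] := sigma_finiteT m1.
have /sigma_finiteP[G [TG ndG Goo]] := sigma_finiteT m2.
exists (fun n => F n `*` G n).
  rewrite -setXTT TF TG predeqE => -[x y]; split.
    move=> [/= [n _ Fnx] [k _ Gky]]; exists (maxn n k) => //; split.
    - by move: x Fnx; exact/subsetPset/ndF/leq_maxl.
    - by move: y Gky; exact/subsetPset/ndG/leq_maxr.
  by move=> [n _ []/= ? ?]; split; exists n.
move=> k; have [? ?] := Foo k; have [? ?] := Goo k.
split; first exact: measurableX.
by rewrite product_measure1E// lte_mul_pinfty// ge0_fin_numE.
Qed.

Section lebesgue_rV_succ.
Context (R : realType) (d : nat).

Definition row_cons (p : measurableTypeR R * 'rV[R]_d) : 'rV[R]_d.+1 :=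
  \row_(i < d.+1) oapp (p.2 0) p.1 (unlift ord0 i).

Lemma measurable_row_cons : measurable_fun setT row_cons.
Proof.
apply: measurable_fun_rVP => i; rewrite /row_cons.
case: (unliftP ord0 i) => [j ->|->].
  under eq_fun do rewrite mxE liftK/=.
  apply: (@measurableT_comp _ _ _ _ _ _
    (fun v : 'rV[R]_d => v 0 j : measurableTypeR R)) => //.
  exact: measurable_coord.
under eq_fun do rewrite mxE unlift_none/=.
exact: measurable_fst.
Qed.

Variable mu : {sigma_finite_measure set 'rV[R]_d -> \bar R}.

Definition lebesgue_rV_succ : set 'rV[R]_d.+1 -> \bar R :=
  pushforward (@lebesgue_measure R \x mu)%E row_cons.

Let m0 : lebesgue_rV_succ set0 = 0%E.
Proof. by rewrite /lebesgue_rV_succ/pushforward preimage_set0 measure0. Qed.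

Let mge0 A : (0 <= lebesgue_rV_succ A)%E.
Proof. exact: (measure_ge0 (@lebesgue_measure R \x mu)%E). Qed.

Let msig : semi_sigma_additive lebesgue_rV_succ.
Proof.
exact: (@measure_semi_sigma_additive _ _ _
  (measure_function_pushforward__canonical__measure_function_Measure
    (@lebesgue_measure R \x mu)%E measurable_row_cons)).
Qed.

HB.instance Definition _ := isMeasure.Build _ _ _ lebesgue_rV_succ m0 mge0 msig.

Definition row_uncons (v : 'rV[R]_d.+1) : measurableTypeR R * 'rV[R]_d :=
  (v 0 ord0, \row_i v 0 (lift ord0 i)).

Lemma row_unconsK : cancel row_uncons row_cons.
Proof.
move=> v; apply/rowP => i; rewrite mxE /=.
by case: (unliftP ord0 i) => [j ->|->] /=; rewrite ?mxE.
Qed.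

Lemma row_consK : cancel row_cons row_uncons.
Proof.
move=> -[x v]; rewrite /row_uncons /row_cons/=; congr pair.
  by rewrite mxE unlift_none.
by apply/rowP => i; rewrite !mxE liftK.
Qed.

Lemma measurable_row_uncons : measurable_fun setT row_uncons.
Proof.
apply/measurable_fun_pairP; split.
  exact: measurable_coord.
apply: measurable_fun_rVP => i; rewrite /comp/=.
under eq_fun do rewrite mxE.
exact: measurable_coord.
Qed.

Let msf : sigma_finite setT lebesgue_rV_succ.
Proof.
have [F TF Ffin] : sigma_finite setT (@lebesgue_measure R \x mu)%E.
  exact: product_sigma_finite.
exists (fun i => row_uncons @^-1` F i).
  by rewrite -preimage_bigcup -TF preimage_setT.
move=> i; have [mF Foo] := Ffin i; split.
  by have := measurable_row_uncons measurableT mF; rewrite setTI.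
rewrite /lebesgue_rV_succ /pushforward -comp_preimage.
rewrite (_ : _ \o _ = idfun) ?preimage_id//.
by apply/funext => x; exact: row_consK.
Qed.

HB.instance Definition _ :=
  Measure_isSigmaFinite.Build _ _ _ lebesgue_rV_succ msf.

End lebesgue_rV_succ.

Fixpoint lebesgue_rV (R : realType) (n : nat) :
    {sigma_finite_measure set 'rV[R]_n -> \bar R} :=
  if n is d.+1 then lebesgue_rV_succ (lebesgue_rV R d) else \d_(0 : 'rV[R]_0).

Lemma lebesgue_rV_box (R : realType) n (A : 'I_n -> set (measurableTypeR R)) :
  (forall i, measurable (A i)) ->
  lebesgue_rV R n [set x | forall i, A i (x 0 i)] =
  (\prod_(i < n) lebesgue_measure (A i))%E.
Proof.
elim: n A => [|n ih] A mA.
  by rewrite big_ord0 /= diracE mem_set//; case.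
rewrite big_ord_recl -ih; last by move=> i; exact: mA.
have mbox : measurable [set x : 'rV[R]_n | forall i, A (lift ord0 i) (x 0 i)].
  have -> : [set x : 'rV[R]_n | forall i, A (lift ord0 i) (x 0 i)] =
      \bigcap_(i in [set: 'I_n])
        ((fun x : 'rV[R]_n => x 0 i : measurableTypeR R) @^-1`
          A (lift ord0 i)).
    by apply/seteqP; split => x /= h i; [move=> _|]; exact: h.
  apply: fin_bigcap_measurable; first exact: finite_finset.
  move=> i _.
  by have := measurable_coord i measurableT (mA (lift ord0 i)); rewrite setTI.
rewrite -product_measure1E//=.
rewrite /lebesgue_rV_succ/pushforward; congr (_ _).
apply/seteqP; split => -[x v] /=.
  move=> h; split; first by have := h ord0; rewrite mxE unlift_none.
  by move=> i; have := h (lift ord0 i); rewrite mxE liftK.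
by move=> [Ax Av] i; rewrite mxE; case: (unliftP ord0 i) => [j ->|->] /=.
Qed.

(* L^1(mu) is the quotient of the library's type of integrable functions by the
   a.e. null ones: the library's LspaceType has no module structure. *)
Section L1.
Context d (T : measurableType d) (R : realType).
Variable mu : {measure set T -> \bar R}.
Local Open Scope quotient_scope.

Notation Lf := (LfunType mu (@lexx _ _ 1%E)).
Implicit Types f g : Lf.

Definition null_Lfun : {pred Lf} := [pred f : Lf | `[< f = 0 %[ae mu] >]].

Lemma null_LfunP f : reflect (f = 0 %[ae mu]) (f \in null_Lfun).
Proof. exact: asboolP. Qed.

Let null_zmod : zmod_closed null_Lfun.
Proof.
split; first by apply/null_LfunP; exact: aeW.
move=> f g /null_LfunP f0 /null_LfunP g0; apply/null_LfunP.
apply: filterS2 f0 g0 => x /(_ I) f0 /(_ I) g0 _.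
transitivity (f x - g x) => //.
by rewrite f0 g0 subr0.
Qed.

HB.instance Definition _ := GRing.isZmodClosed.Build Lf null_Lfun null_zmod.

Definition L1 := Quotient.quot null_Lfun.

HB.instance Definition _ := GRing.Zmodule.on L1.
HB.instance Definition _ := EqQuotient.on L1.

Implicit Types u v : L1.

Definition L1_fun u : T -> R := repr u.
Coercion L1_fun : L1 >-> Funclass.

Lemma L1_eqP f g : reflect (f = g %[ae mu]) (\pi_L1 f == \pi_L1 g).
Proof.
rewrite -Quotient.idealrBE; apply: (iffP (null_LfunP _)).
  by apply: filterS => x /(_ I) fg _; apply/subr0_eq/fg.
apply: filterS => x /(_ I) fg _; transitivity (f x - g x) => //.
by rewrite fg subrr.
Qed.

Lemma repr_L1 f : repr (\pi_L1 f) = f %[ae mu].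
Proof. by apply/L1_eqP; rewrite reprK. Qed.

Lemma L1_piD f g : \pi_L1 f + \pi_L1 g = \pi_L1 (f + g).
Proof. exact/esym/Quotient.pi_add. Qed.

Definition L1_scale (a : R) u : L1 := \pi_L1 (a *: repr u).

Let pi_scale a f : L1_scale a (\pi_L1 f) = \pi_L1 (a *: f).
Proof.
apply/eqP/L1_eqP; have := repr_L1 f.
apply: filterS => x /(_ I) fx _;
exact: (congr1 ( *%R a) fx).
Qed.

Let L1_scaleA a b u : L1_scale a (L1_scale b u) = L1_scale (a * b) u.
Proof. by rewrite [L1_scale b u]/L1_scale pi_scale /L1_scale scalerA. Qed.

Let L1_scale1 : left_id 1 L1_scale.
Proof. by move=> u; rewrite /L1_scale scale1r reprK. Qed.

Let L1_scaleDr : right_distributive L1_scale +%R.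
Proof.
move=> a u v; rewrite -[u]reprK -[v]reprK.
by rewrite !pi_scale !L1_piD pi_scale scalerDr.
Qed.

Let L1_scaleDl u : {morph L1_scale^~ u : a b / a + b}.
Proof. by move=> a b; rewrite -[u]reprK !pi_scale L1_piD scalerDl. Qed.

HB.instance Definition _ := GRing.Zmodule_isLmodule.Build R L1
  L1_scaleA L1_scale1 L1_scaleDr L1_scaleDl.

Definition L1_norm u : R := fine ('N[mu]_1[EFin \o u])%E.

Lemma L1_norm_pi f : L1_norm (\pi_L1 f) = fine ('N[mu]_1[EFin \o f])%E.
Proof.
congr fine; rewrite !Lnorm1.
have mabs (g : Lf) :
    measurable_fun [set: T] (abse \o (EFin \o g) : T -> \bar R).
  apply: measurableT_comp => //; apply/measurable_EFinP.
  exact: measurable_funPT.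
apply: ae_eq_integral => //; try exact: mabs.
by have := repr_L1 f; apply: filterS => x /(_ I) fx _; congr (`|_%:E|)%E.
Qed.

Let L1_normD u v : L1_norm (u + v) <= L1_norm u + L1_norm v.
Proof.
by rewrite -[u]reprK -[v]reprK L1_piD !L1_norm_pi; exact: ler_LnormD.
Qed.

Let L1_normZ a u : L1_norm (a *: u) = `|a| * L1_norm u.
Proof.
rewrite -[u]reprK -[_ *: _]/(L1_scale _ _) pi_scale !L1_norm_pi.
apply: EFin_inj; rewrite finite_norm_fine (LnormZ (repr u) a) EFinM.
by rewrite finite_norm_fine.
Qed.

Let L1_norm0 u : L1_norm u = 0 -> u = 0.
Proof.
move=> /(@fine_Lnormr_eq0 _ _ _ mu 1%E (lexx _) (repr u)) u0.
have -> : 0 = \pi_L1 (0 : Lf).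
  by apply: (addrI (\pi_L1 0)); rewrite addr0 L1_piD addr0.
by rewrite -[u]reprK; apply/eqP/L1_eqP.
Qed.

HB.instance Definition _ := Lmodule_isNormed.Build R L1
  L1_normD L1_normZ L1_norm0.

Lemma L1_normE u : (`|u|%:E = \int[mu]_x `|u x|%:E)%E.
Proof.
rewrite -[`|u|]/(L1_norm u) /L1_norm finite_norm_fine Lnorm1.
by [].
Qed.

End L1.

Section calculus.
Context {R : realType} {n : nat}.
Implicit Types (u f : 'rV[R]_n -> R) (x h : 'rV[R]_n).

Definition eucl_norm x : R := Num.sqrt (\sum_(i < n) x 0 i ^+ 2).

Definition partial (i : 'I_n) u : 'rV[R]_n -> R :=
  fun x => 'D_(delta_mx 0 i) u x.

Definition partials (s : seq 'I_n) u : 'rV[R]_n -> R := foldr partial u s.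

Definition smooth u : Prop := forall s : seq 'I_n,
  continuous (partials s u) /\
  forall i x, derivable (partials s u) x (delta_mx 0 i).

Definition Cc_infty : set ('rV[R]_n -> R) :=
  [set u | smooth u /\ compact (closure [set x | u x != 0])].

(* Euclidean norm of the tensor of all the k-th order partial derivatives. *)
Definition norm_Dk (k : nat) u x : R :=
  Num.sqrt (\sum_(s : k.-tuple 'I_n) partials s u x ^+ 2).

(* The condition i.+1 = n singles out the last coordinate. *)
Definition half_space : set 'rV[R]_n :=
  [set x | forall i : 'I_n, i.+1 = n -> 0 < x 0 i].

Definition normal_vector : 'rV[R]_n := \row_i (i.+1 == n)%:R.

Definition boundary (y : 'rV[R]_n.-1) : 'rV[R]_n :=
  \row_(i < n) oapp (y 0) 0 (insub (i : nat)).

(* The j-th normal derivative of u on the boundary of the half-space. *)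
Definition normal_trace (j : nat) u : 'rV[R]_n.-1 -> R :=
  iter j (fun v x => 'D_normal_vector v x) u \o boundary.

Definition sobolev_norm (k : nat) u : \bar R :=
  \int[lebesgue_rV R n]_(x in half_space) (norm_Dk k u x)%:E.

Definition restrict_half u : 'rV[R]_n -> R := patch (fun=> 0) half_space u.

Definition finite_diff (m : nat) h f x : R :=
  \sum_(i < m.+1) (-1) ^+ (m - i) * 'C(m, i)%:R * f (x + i%:R *: h).

Definition besov_norm (s : R) (m : nat) f : \bar R :=
  \int[lebesgue_rV R n]_h
    ((\int[lebesgue_rV R n]_x `|finite_diff m h f x|%:E) *
     ((eucl_norm h `^ (n%:R + s))^-1)%:E).

End calculus.

(* A completion of the space S of real-valued functions for the norm N is a
   Banach space with a dense isometric linear embedding of S; it is unique up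
   to a unique isometric isomorphism. *)
Record completion (R : realType) (X : Type) (S : set (X -> R))
    (N : (X -> R) -> \bar R) := Completion {
  completion_space :> completeNormedModType R;
  completion_emb : (X -> R) -> completion_space;
  completion_linear : forall (a : R) (u v : X -> R), S u -> S v ->
    completion_emb (fun x => a * u x + v x) =
    a *: completion_emb u + completion_emb v;
  completion_norm : forall u, S u -> (`|completion_emb u|%:E = N u)%E;
  completion_dense : dense (completion_emb @` S)
}.

Definition sobolev_space (R : realType) (n k : nat) :=
  completion (restrict_half @` @Cc_infty R n) (sobolev_norm k).

Definition besov_space (R : realType) (n : nat) (s : R) (m : nat) :=
  completion (@Cc_infty R n) (besov_norm s m).

Arguments besov_space : clear implicits.

Section trace_space.
Context {R : realType} {d k : nat}.
Variable B : 'I_k.-1 -> normedModType R.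

Record trace_space := TraceSpace {
  trace_besov : forall j, B j;
  trace_L1 : L1 (lebesgue_rV R d)
}.
Implicit Types f g : trace_space.

Lemma trace_space_eq f g : trace_besov f = trace_besov g ->
  trace_L1 f = trace_L1 g -> f = g.
Proof. by case: f g => [f f'] [g g'] /= -> ->. Qed.

Let ext f g : (forall j, trace_besov f j = trace_besov g j) ->
  trace_L1 f = trace_L1 g -> f = g.
Proof.
by move=> fg; apply: trace_space_eq; exact: functional_extensionality_dep.
Qed.

HB.instance Definition _ := gen_eqMixin trace_space.
HB.instance Definition _ := gen_choiceMixin trace_space.

Let tzero := TraceSpace (fun=> 0) 0.
Let topp f := TraceSpace (fun j => - trace_besov f j) (- trace_L1 f).
Let tadd f g := TraceSpace (fun j => trace_besov f j + trace_besov g j)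
  (trace_L1 f + trace_L1 g).
Let tscale (a : R) f :=
  TraceSpace (fun j => a *: trace_besov f j) (a *: trace_L1 f).

Let taddA : associative tadd.
Proof. by move=> f g h; apply: ext => [j|]; exact: addrA. Qed.
Let taddC : commutative tadd.
Proof. by move=> f g; apply: ext => [j|]; exact: addrC. Qed.
Let tadd0 : left_id tzero tadd.
Proof. by move=> f; apply: ext => [j|]; exact: add0r. Qed.
Let taddN : left_inverse tzero topp tadd.
Proof. by move=> f; apply: ext => [j|]; exact: addNr. Qed.

HB.instance Definition _ :=
  GRing.isZmodule.Build trace_space taddA taddC tadd0 taddN.

Let tscaleA a b f : tscale a (tscale b f) = tscale (a * b) f.
Proof. by apply: ext => [j|]; exact: scalerA. Qed.
Let tscale1 : left_id 1 tscale.
Proof. by move=> f; apply: ext => [j|]; exact: scale1r. Qed.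
Let tscaleDr : right_distributive tscale +%R.
Proof. by move=> a f g; apply: ext => [j|]; exact: scalerDr. Qed.
Let tscaleDl f : {morph tscale^~ f : a b / a + b}.
Proof. by move=> a b; apply: ext => [j|]; exact: scalerDl. Qed.

HB.instance Definition _ := GRing.Zmodule_isLmodule.Build R trace_space
  tscaleA tscale1 tscaleDr tscaleDl.

Definition trace_norm f : R := \sum_j `|trace_besov f j| + `|trace_L1 f|.

Let trace_normD f g : trace_norm (f + g) <= trace_norm f + trace_norm g.
Proof.
rewrite /trace_norm addrACA -big_split/=.
by rewrite lerD ?ler_normD// ler_sum// => j _; exact: ler_normD.
Qed.

Let trace_normZ (a : R) f : trace_norm (a *: f) = `|a| * trace_norm f.
Proof.
rewrite /trace_norm mulrDr mulr_sumr; congr (_ + _); last exact: normrZ.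
by apply: eq_bigr => j _; exact: normrZ.
Qed.

Let trace_norm0 f : trace_norm f = 0 -> f = 0.
Proof.
move=> /eqP; rewrite paddr_eq0 ?sumr_ge0// psumr_eq0// normr_eq0.
move=> /andP[/allP f0 /eqP f10]; apply: ext => // j.
by have := f0 j (mem_index_enum j); rewrite normr_eq0 => /eqP.
Qed.

HB.instance Definition _ := Lmodule_isNormed.Build R trace_space
  trace_normD trace_normZ trace_norm0.

End trace_space.
Arguments trace_space {R} d {k} B.

(* The values of tr on the dense image of C_c^oo(R^n), which determine a
   continuous tr. For j <= k-2 the j-th trace lies in the Besov space of order
   k-1-j, so the index set 'I_k.-1 is empty when k = 1. *)
Definition extends_trace (R : realType) (n k : nat) (m : 'I_k.-1 -> nat)
    (W : sobolev_space R n k)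
    (B : forall j : 'I_k.-1, besov_space R n.-1 (k.-1 - j)%N%:R (m j))
    (tr : W -> trace_space n.-1 B) : Prop :=
  forall u, Cc_infty u ->
    let t := tr (completion_emb W (restrict_half u)) in
    (forall j : 'I_k.-1,
       trace_besov t j = completion_emb (B j) (normal_trace j u)) /\
    trace_L1 t = normal_trace k.-1 u %[ae lebesgue_rV R n.-1].

(* Main.v *)
(** Only the top component of the trace matters: a right inverse E restricts to
    a bounded linear map g from L^1 of the boundary to W^{k,1}, f |-> E(0,..,0,f).
    Cut the unit cube of the boundary into M slabs orthogonal to the first axis,
    with indicators c_1, .., c_M.  The sum of the norms |g c_i| is bounded and
    increases under refinement of the partition, so from some partition on a
    refinement gains almost nothing.  Hence for all finer partitions the functions
    g c_i have, in total, as little D^k-mass in a thin layer 0 < x_n < T as the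
    finitely many functions of one fixed partition: the smallness is uniform in M.
    Now consider u = g r with r = sum_i (-1)^i c_i and v = d_n^{k-1} u, so that
    v = r on the boundary.  For 0 < t < T, v(., t) is L^1-close to r because
    d_n v has small mass in the layer, whereas r oscillates at scale 1/M, which
    forces the L^1 norm of d_1 v(., t) to be at least of order M.  Integrating in
    t contradicts the boundedness of the norm of u as M tends to infinity. *)
Require Import Defs.
From HB Require Import structures.
From mathcomp Require Import all_boot all_order all_algebra.
From mathcomp Require Import all_classical all_reals all_analysis.
From mathcomp Require Import measurable_realfun ring lra.
Set Implicit Arguments.
Unset Strict Implicit.
Unset Printing Implicit Defensive.
Import Order.TTheory GRing.Theory Num.Theory.
Import numFieldNormedType.Exports.
Local Open Scope classical_set_scope.
Local Open Scope ring_scope.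

(** * Partial derivatives *)

Lemma partials_linear (R : realType) n (a : R) (u v : 'rV[R]_n -> R) s :
  smooth u -> smooth v ->
  partials s (fun x => a * u x + v x) =
  (fun x => a * partials s u x + partials s v x).
Proof.
move=> su sv; elim: s => [//|i s ih] /=; rewrite ih; apply/funext => x.
have du := (su s).2 i x; have dv := (sv s).2 i x.
rewrite /partial.
have -> : (fun y => a * partials s u y + partials s v y) =
    (a *: partials s u + partials s v) by [].
by rewrite deriveD ?deriveZ//; exact: derivableZ.
Qed.

Lemma smooth_linear (R : realType) n (a : R) (u v : 'rV[R]_n -> R) :
  smooth u -> smooth v -> smooth (fun x => a * u x + v x).
Proof.
move=> su sv s; rewrite partials_linear//; split.
  move=> x; apply: (@continuousD _ _ _ (a *: partials s u) (partials s v) x).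
    exact: (continuousZr ((su s).1 x)).
  exact: ((sv s).1 x).
move=> i x.
have -> : (fun y => a * partials s u y + partials s v y) =
    (a *: partials s u + partials s v) by [].
apply: derivableD; last exact: (sv s).2.
by apply: derivableZ; exact: (su s).2.
Qed.

Lemma Cc_infty_linear (R : realType) n (a : R) (u v : 'rV[R]_n -> R) :
  Cc_infty u -> Cc_infty v -> Cc_infty (fun x => a * u x + v x).
Proof.
move=> [su cu] [sv cv]; split; first exact: smooth_linear.
apply: (@subclosed_compact _ _ (closure [set x | u x != 0] `|`
    closure [set x | v x != 0])); first exact: closed_closure.
- exact: compactU.
- rewrite -closureU; apply: closure_subset => x /=.
  apply: contra_neqP => /not_orP[/negP/negPn/eqP-> /negP/negPn/eqP->].
  by rewrite mulr0 addr0.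
Qed.

Lemma partials0 (R : realType) n s :
  partials s (fun _ : 'rV[R]_n => 0 : R) = (fun=> 0).
Proof.
elim: s => [//|i s ih] /=; rewrite ih; apply/funext => x.
exact: (@derive_cst _ _ _ (0 : R)).
Qed.

Lemma Cc_infty0 (R : realType) n : Cc_infty (fun _ : 'rV[R]_n => 0 : R).
Proof.
split.
  move=> s; rewrite partials0.
  by split => [x|i x]; [exact: cst_continuous|exact: derivable_cst].
rewrite (_ : [set _ | _] = set0) ?closure0; first exact: compact0.
by apply/seteqP; split => // x /=; rewrite eqxx.
Qed.

Lemma restrict_half_linear (R : realType) n (a : R) (u v : 'rV[R]_n -> R) :
  restrict_half (fun x => a * u x + v x) =
  (fun x => a * restrict_half u x + restrict_half v x).
Proof.
apply/funext => x; rewrite /restrict_half /patch.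
by case: ifPn => // _; rewrite mulr0 addr0.
Qed.

(** * Derivatives and norms on the half-space *)

Lemma half_spaceE (R : realType) d :
  @half_space R d.+1 = [set x | 0 < x 0 ord_max].
Proof.
apply/seteqP; split => x /=; first by apply.
by move=> x0 i [id]; rewrite (_ : i = ord_max)//; exact/val_inj.
Qed.

Lemma open_half_space (R : realType) d : open (@half_space R d.+1).
Proof.
rewrite half_spaceE.
apply: (@open_comp _ _ (fun x : 'rV[R]_d.+1 => x 0 ord_max) [set y | 0 < y]).
  by move=> x _; exact: coord_continuous.
exact: open_gt.
Qed.

(** Derivatives are local and the half-space is open, so the jump of the zero extension across the
    boundary is never seen. *)
Lemma partials_restrict_half (R : realType) d (u : 'rV[R]_d.+1 -> R) s x :
  half_space x -> partials s (restrict_half u) x = partials s u x.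
Proof.
elim: s x => [|i s ih] x hx /=; first by rewrite /restrict_half patchE mem_set.
apply: near_eq_derive.
have := open_nbhs_nbhs (conj (open_half_space (R := R) (d := d)) hx).
by apply: filterS => y; exact: ih.
Qed.

Lemma norm_Dk_restrict_half (R : realType) d k (u : 'rV[R]_d.+1 -> R) x :
  half_space x -> norm_Dk k (restrict_half u) x = norm_Dk k u x.
Proof.
move=> hx; rewrite /norm_Dk; congr Num.sqrt; apply: eq_bigr => s _.
by rewrite partials_restrict_half.
Qed.

Lemma norm_Dk_ge0 (R : realType) n k (u : 'rV[R]_n -> R) x : 0 <= norm_Dk k u x.
Proof. exact: sqrtr_ge0. Qed.

Lemma ler_partials_norm_Dk (R : realType) n k (s : k.-tuple 'I_n)
    (u : 'rV[R]_n -> R) x : `|partials s u x| <= norm_Dk k u x.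
Proof.
rewrite -sqrtr_sqr; apply: ler_wsqrtr.
rewrite (bigD1 s)//= lerDl; apply: sumr_ge0 => t _; exact: sqr_ge0.
Qed.

(** Minkowski's inequality for the Euclidean norm, deduced from Cauchy-Schwarz; it makes [norm_Dk]
    subadditive. *)
Lemma ler_sqrt_sumD (R : realType) (I : finType) (a b : I -> R) :
  Num.sqrt (\sum_i (a i + b i) ^+ 2) <=
  Num.sqrt (\sum_i a i ^+ 2) + Num.sqrt (\sum_i b i ^+ 2).
Proof.
set A := \sum_i a i ^+ 2; set B := \sum_i b i ^+ 2.
have A0 : 0 <= A by apply: sumr_ge0 => i _; exact: sqr_ge0.
have B0 : 0 <= B by apply: sumr_ge0 => i _; exact: sqr_ge0.
set S := Num.sqrt A; set T := Num.sqrt B.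
have S0 : 0 <= S by exact: sqrtr_ge0.
have T0 : 0 <= T by exact: sqrtr_ge0.
have SA : S ^+ 2 = A by exact: sqr_sqrtr.
have TB : T ^+ 2 = B by exact: sqr_sqrtr.
rewrite -[leRHS]ger0_norm ?addr_ge0// -sqrtr_sqr; apply: ler_wsqrtr.
pose P := \sum_i a i * b i.
have PST : P <= S * T.
  (* This expands the sum of the squares [(T * a i - S * b i) ^+ 2]. As [S ^+ 2 = A] and
     [T ^+ 2 = B], it equals [(S * T) ^+ 2 *+ 2 - (S * T * P) *+ 2], and dividing by [S * T] bounds
     [P]. *)
  have key : 0 <= T ^+ 2 * A - (S * T * P) *+ 2 + S ^+ 2 * B.
    rewrite [leRHS](_ : _ = \sum_i (T * a i - S * b i) ^+ 2).
      by apply: sumr_ge0 => i _; exact: sqr_ge0.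
    rewrite /A /B /P !mulr_sumr -sumrMnl -sumrB -big_split/=.
    by apply: eq_bigr => i _; ring.
  (* If [S * T = 0] one cannot divide, but then one of the two families vanishes and so does [P]. *)
  have [ST0|ST0] := eqVneq (S * T) 0.
    rewrite ST0; move/eqP: ST0; rewrite mulf_eq0 => /orP[/eqP S00|/eqP T00].
      have /eqP : A = 0 by rewrite -SA S00 expr0n.
      rewrite psumr_eq0 => [/allP az|i _]; last exact: sqr_ge0.
      rewrite /P big1// => i _.
      have := az i (mem_index_enum i).
      by rewrite sqrf_eq0 => /eqP ->; rewrite mul0r.
    have /eqP : B = 0 by rewrite -TB T00 expr0n.
    rewrite psumr_eq0 => [/allP az|i _]; last exact: sqr_ge0.
    rewrite /P big1// => i _.
    have := az i (mem_index_enum i).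
    by rewrite sqrf_eq0 => /eqP ->; rewrite mulr0.
  have STp : 0 < S * T by rewrite lt_neqAle eq_sym ST0 mulr_ge0.
  move: key; rewrite -SA -TB -exprMn [T * S]mulrC -exprMn addrAC -mulr2n subr_ge0.
  by rewrite lerMn2r /= expr2 ler_pM2l.
rewrite sqrrD SA TB.
rewrite [leLHS](_ : _ = A + P *+ 2 + B).
  by rewrite lerD2r lerD2l lerMn2r.
rewrite /A /B /P -sumrMnl -!big_split/=; apply: eq_bigr => i _.
by rewrite sqrrD.
Qed.

Lemma norm_Dk0 (R : realType) n k (x : 'rV[R]_n) : norm_Dk k (fun=> 0) x = 0.
Proof.
rewrite /norm_Dk big1 ?sqrtr0// => s _.
by rewrite partials0 expr0n.
Qed.

Lemma norm_Dk_linear (R : realType) n k (a : R) (u v : 'rV[R]_n -> R) x :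
  smooth u -> smooth v ->
  norm_Dk k (fun y => a * u y + v y) x <= `|a| * norm_Dk k u x + norm_Dk k v x.
Proof.
move=> su sv; rewrite -sqrtr_sqr -sqrtrM ?sqr_ge0// mulr_sumr.
under [X in Num.sqrt X + _]eq_bigr => s _ do rewrite -exprMn.
apply: le_trans (ler_sqrt_sumD _ _).
by rewrite /norm_Dk; under eq_bigr => s _ do rewrite partials_linear//.
Qed.

Lemma normal_vectorE (R : realType) d :
  @normal_vector R d.+1 = delta_mx 0 ord_max.
Proof.
by apply/rowP => i; rewrite !mxE eqxx/= eqSS; congr (nat_of_bool _)%:R.
Qed.

Lemma normal_traceE (R : realType) d j (u : 'rV[R]_d.+1 -> R) :
  normal_trace j u = partials (nseq j ord_max) u \o boundary.
Proof.
rewrite /normal_trace normal_vectorE; congr (_ \o _).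
by elim: j => [//|j /= ->].
Qed.

(** * Lebesgue measure on row vectors *)

Lemma measurable_box (R : realType) n (A : 'I_n -> set (measurableTypeR R)) :
  (forall i, measurable (A i)) ->
  measurable [set x : 'rV[R]_n | forall i, A i (x 0 i)].
Proof.
move=> mA.
have -> : [set x : 'rV[R]_n | forall i, A i (x 0 i)] =
    \bigcap_(i in [set: 'I_n])
      ((fun x : 'rV[R]_n => x 0 i : measurableTypeR R) @^-1` A i).
  by apply/seteqP; split => x /= h i; [move=> _|]; exact: h.
apply: fin_bigcap_measurable; first exact: finite_finset.
by move=> i _; have := measurable_coord i measurableT (mA i); rewrite setTI.
Qed.

(** Rounding down to the grid of mesh [1 / k.+1] moves each coordinate by less than the mesh, and
    the norm is the maximum over the coordinates. *)
Lemma cvg_floor_grid (R : realType) n (x : 'rV[R]_n) :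
  \row_i ((Num.floor (k.+1%:R * x 0 i))%:~R / k.+1%:R) @[k --> \oo] --> x.
Proof.
apply/cvgrPdist_lt => e e0; near=> k.
set y := \row_i _.
suff : mx_norm (x - y) < e by [].
have [->//|/mx_norm_neq0[[i j] ->]] := eqVneq (mx_norm (x - y)) 0.
rewrite !mxE /= ord1.
have k0 : 0 < k.+1%:R :> R by rewrite ltr0n.
have /andP[h1 h2] := floor_itv (k.+1%:R * x 0 j).
rewrite ger0_norm; last by rewrite subr_ge0 ler_pdivrMr// [x 0 j * _]mulrC.
have {}h2 : x 0 j < (Num.floor (k.+1%:R * x 0 j) + 1)%:~R / k.+1%:R.
  by rewrite ltr_pdivlMr// [x 0 j * _]mulrC.
rewrite ltrBlDr; apply: (lt_trans h2); rewrite intrD mulrDl mul1r addrC ltrD2r.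
by near: k; exact: (near_infty_natSinv_lt (PosNum e0)).
Unshelve. all: by end_near. Qed.

(* A continuous function is the pointwise limit of its values on finer and
   finer grids, which take countably many values on boxes. *)
Lemma continuous_measurable_rV (R : realType) n (f : 'rV[R]_n -> R) :
  continuous f -> measurable_fun setT f.
Proof.
move=> cf.
apply: (@measurable_fun_cvg _ _ _ setT (fun k (x : 'rV[R]_n) =>
    f (\row_i ((Num.floor (k.+1%:R * x 0 i))%:~R / k.+1%:R)))); last first.
  by move=> x _; exact: cvg_comp (@cvg_floor_grid R n x) (cf x).
move=> k _ B mB; rewrite setTI.
have k0 : 0 < k.+1%:R :> R by rewrite ltr0n.
(* [F z] gathers the points of the preimage that round down to the grid point of index [z]: a whole
   box or nothing, and there are countably many [z]. *)
pose F (z : 'rV[int]_n) := [set x : 'rV[R]_n |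
  B (f (\row_i ((z 0 i)%:~R / k.+1%:R))) /\
  forall i, [set y | Num.floor (k.+1%:R * y) = z 0 i] (x 0 i)].
rewrite (_ : _ @^-1` B = \bigcup_z F z); last first.
  apply/seteqP; split => x /=.
    move=> Bx; exists (\row_i Num.floor (k.+1%:R * x 0 i)) => //; split.
      by under eq_mx do rewrite mxE.
    by move=> i; rewrite mxE.
  move=> [z _ [Bz xz]]; rewrite (_ : \row_i _ = \row_i ((z 0 i)%:~R / k.+1%:R))//.
  by apply/rowP => i; rewrite !mxE xz.
apply: countable_bigcupT_measurable => [|z]; first exact: countableP.
have [Bz|nBz] := pselect (B (f (\row_i ((z 0 i)%:~R / k.+1%:R)))); last first.
  by rewrite (_ : F z = set0)//; apply/seteqP; split => // x [].
rewrite (_ : F z = [set x : 'rV[R]_n |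
  forall i, [set y | Num.floor (k.+1%:R * y) = z 0 i] (x 0 i)]); last first.
  by apply/seteqP; split => x // [].
apply: (@measurable_box _ _ (fun i => [set y | Num.floor (k.+1%:R * y) = z 0 i])).
move=> i; rewrite (_ : [set _ | _] =
    `[(z 0 i)%:~R / k.+1%:R, (z 0 i + 1)%:~R / k.+1%:R[%classic).
  exact: measurable_itv.
apply/seteqP; split => y /=; rewrite in_itv/= ler_pdivrMr// ltr_pdivlMr// mulrC.
  by move=> <-; exact: floor_itv.
exact: floor_def.
Qed.

(** The height above the boundary is the last coordinate, whereas [lebesgue_rV] is built by adding
    first coordinates, so [row_cons] and [row_snoc] both occur. The form boundary point plus
    multiple of the normal fits [derive_line]. *)
Definition row_snoc (R : realType) d (x : 'rV[R]_d) (t : R) : 'rV[R]_d.+1 :=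
  @boundary R d.+1 x + t *: delta_mx 0 ord_max.

Lemma row_snocE (R : realType) d (x : 'rV[R]_d) t i :
  row_snoc x t 0 i = oapp (x 0) t (insub (i : nat)).
Proof.
rewrite !mxE eqxx/=; case: insubP => /= [j _ ji|].
  rewrite (_ : i == ord_max = false) ?mulr0 ?addr0//.
  by apply/negbTE; rewrite -val_eqE/= -ji neq_ltn ltn_ord.
rewrite -leqNgt => di; rewrite add0r (_ : i == ord_max) ?mulr1//.
by rewrite -val_eqE/= eqn_leq di -ltnS ltn_ord.
Qed.

Lemma row_snoc_last (R : realType) d (x : 'rV[R]_d) t :
  row_snoc x t 0 ord_max = t.
Proof. by rewrite row_snocE insubF// ltnn. Qed.

Lemma row_snoc0 (R : realType) d (x : 'rV[R]_d) :
  row_snoc x 0 = @boundary R d.+1 x.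
Proof. by rewrite /row_snoc scale0r addr0. Qed.

(** The exchange that drives the induction in [lebesgue_rV_integral_snoc]. *)
Lemma row_snoc_cons (R : realType) d (x1 t : R) (y : 'rV[R]_d) :
  row_snoc (row_cons (x1, y)) t = row_cons (x1, row_snoc y t).
Proof.
apply/rowP => i; rewrite row_snocE [in RHS]mxE /=.
case: (unliftP ord0 i) => [j ->|->] /=.
  rewrite row_snocE; case: insubP => /= [k _ kj|].
    rewrite mxE; case: (unliftP ord0 k) kj => [l ->|->] //= [lj].
    by move: lj; rewrite !add0n => <-; rewrite valK.
  by rewrite /bump leq0n add1n ltnS => jd; rewrite insubF//; exact/negbTE.
by rewrite insubT//= mxE; case: unliftP => // j /(congr1 val).
Qed.

Lemma measurable_row_snoc (R : realType) d :
  measurable_fun setT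
    (fun p : 'rV[R]_d * measurableTypeR R => row_snoc p.1 p.2).
Proof.
apply: measurable_fun_rVP => i; under eq_fun do rewrite row_snocE.
case: insubP => /= [j _ _|_]; last exact: measurable_snd.
apply: (@measurableT_comp _ _ _ _ _ _
  (fun v : 'rV[R]_d => v 0 j : measurableTypeR R)) => //.
exact: measurable_coord.
Qed.

Lemma lebesgue_rV_integral_cons (R : realType) d (g : 'rV[R]_d.+1 -> \bar R) :
  measurable_fun setT g -> (forall x, 0 <= g x)%E ->
  (\int[lebesgue_rV R d.+1]_x g x =
   \int[lebesgue_measure]_x1 \int[lebesgue_rV R d]_y g (row_cons (x1, y)))%E.
Proof.
move=> mg g0.
rewrite (ge0_integral_pushforward (@measurable_row_cons R d))//.
rewrite preimage_setT fubini_tonelli1//=.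
exact: measurableT_comp mg (measurable_row_cons (R := R) (d := d)).
Qed.

Lemma lebesgue_rV_integral_cons_swap (R : realType) d
    (g : 'rV[R]_d.+1 -> \bar R) :
  measurable_fun setT g -> (forall x, 0 <= g x)%E ->
  (\int[lebesgue_rV R d.+1]_x g x =
   \int[lebesgue_rV R d]_y \int[lebesgue_measure]_x1 g (row_cons (x1, y)))%E.
Proof.
move=> mg g0.
rewrite (ge0_integral_pushforward (@measurable_row_cons R d))//.
rewrite preimage_setT fubini_tonelli2//=.
exact: measurableT_comp mg (measurable_row_cons (R := R) (d := d)).
Qed.

Lemma measurable_integral_row_snoc (R : realType) d (g : 'rV[R]_d.+1 -> \bar R) :
  measurable_fun setT g -> (forall x, 0 <= g x)%E ->
  measurable_fun setT
    (fun x : 'rV[R]_d => \int[lebesgue_measure]_t g (row_snoc x t))%E.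
Proof.
move=> mg g0.
apply: (measurable_fun_fubini_tonelli_F
  (fun p : 'rV[R]_d * measurableTypeR R => g (row_snoc p.1 p.2))) => //.
exact: measurableT_comp mg (measurable_row_snoc (R := R) (d := d)).
Qed.

Lemma measurable_integral_row_cons (R : realType) d (g : 'rV[R]_d.+1 -> \bar R) :
  measurable_fun setT g -> (forall x, 0 <= g x)%E ->
  measurable_fun setT
    (fun y : 'rV[R]_d => \int[lebesgue_measure]_x1 g (row_cons (x1, y)))%E.
Proof.
move=> mg g0.
apply: (measurable_fun_fubini_tonelli_G
  (fun p : measurableTypeR R * 'rV[R]_d => g (row_cons p))) => //.
exact: measurableT_comp mg (measurable_row_cons (R := R) (d := d)).
Qed.

(** Induction on the dimension: the first coordinate is split off, the formula is applied to the
    remaining ones, and the first coordinate is put back by [row_snoc_cons]. In dimension 1 the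
    first and the last coordinate coincide. *)
Lemma lebesgue_rV_integral_snoc (R : realType) d (g : 'rV[R]_d.+1 -> \bar R) :
  measurable_fun setT g -> (forall x, 0 <= g x)%E ->
  (\int[lebesgue_rV R d.+1]_x g x =
   \int[lebesgue_rV R d]_x \int[lebesgue_measure]_t g (row_snoc x t))%E.
Proof.
elim: d g => [|d ih] g mg g0.
  rewrite lebesgue_rV_integral_cons_swap//= !integral_dirac//.
  - congr (_ * _)%E; apply: eq_integral => t _; congr g.
    apply/rowP => i; rewrite row_snocE mxE !ord1 unlift_none.
    by case: insubP => [[]|].
  - exact: measurable_integral_row_snoc.
  - exact: measurable_integral_row_cons.
rewrite lebesgue_rV_integral_cons//.
under eq_integral => x1 _.
  rewrite ih//; last first.
    apply: measurableT_comp mg _.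
    apply: measurableT_comp (measurable_row_cons (R := R) (d := d.+1)) _.
    exact: pair1_measurable.
  under eq_integral do under eq_integral do rewrite -row_snoc_cons.
  over.
rewrite [RHS]lebesgue_rV_integral_cons//.
- exact: measurable_integral_row_snoc.
- by move=> x; apply: integral_ge0.
Qed.

(** * Oscillation near the boundary *)

(** The difference quotients agree exactly, so both differentiability and the value of the
    derivative pass from the space to a line. *)
Lemma line_quotient (R : realType) (V : normedModType R) (u : V -> R) (p e : V)
    (s : R) :
  (fun h : R => h^-1 *: (((fun s : R => u (p + s *: e)) \o shift s) (h *: 1) -
     u (p + s *: e))) =
  (fun h : R => h^-1 *: ((u \o shift (p + s *: e)) (h *: e) -
     u (p + s *: e))).
Proof.
apply/funext => h /=; congr (_ *: (u _ - _)).
by rewrite [_%:A]mulr1 scalerDl addrCA.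
Qed.

Lemma derive_line (R : realType) (V : normedModType R) (u : V -> R) (p e : V)
    (s : R) :
  'D_1 (fun s : R => u (p + s *: e)) s = 'D_e u (p + s *: e).
Proof. by rewrite /derive line_quotient. Qed.

Lemma derivable_line (R : realType) (V : normedModType R) (u : V -> R) (p e : V)
    (s : R) :
  derivable u (p + s *: e) e -> derivable (fun s : R => u (p + s *: e)) s 1.
Proof. by rewrite /derivable line_quotient. Qed.

Lemma continuous_line (R : realType) (V : normedModType R) (p e : V) :
  continuous (fun s : R => p + s *: e).
Proof.
move=> s; apply: (@continuousD _ _ _ (cst p) (fun s : R => s *: e) s).
  exact: cst_continuous.
exact: scalel_continuous.
Qed.

(** The fundamental theorem of calculus, then the triangle inequality for integrals. *)
Lemma ler_dist_integral_derive (R : realType) (f : R -> R) a b : a <= b ->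
  (forall s, derivable f s 1) -> continuous (fun s => 'D_1 f s) ->
  (`|f b - f a|%:E <= \int[lebesgue_measure]_(s in `[a, b]) `|'D_1 f s|%:E)%E.
Proof.
rewrite le_eqVlt => /predU1P[<- _ _|ab df cf].
  by rewrite subrr normr0; exact: integral_ge0.
have fc : continuous f.
  by move=> s; apply: differentiable_continuous; exact/derivable1_diffP.
have cf' : {within `[a, b], continuous (fun s => 'D_1 f s)}.
  exact: continuous_subspaceT.
rewrite -[X in (X <= _)%E]/(`|(f b - f a)%:E|)%E EFinB.
rewrite -(@continuous_FTC2 _ (fun s => 'D_1 f s) f a b)//; last 2 first.
- split; first by move=> x _; exact: df.
    exact: cvg_at_right_filter (fc a).
  exact: cvg_at_left_filter (fc b).
- by move=> x _; rewrite derive1E.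
apply: le_abse_integral => //.
apply/measurable_EFinP; apply: measurable_funTS.
exact: continuous_measurable_fun.
Qed.

Lemma ler_dist_integral_line (R : realType) (V : normedModType R) (u : V -> R)
    (p e : V) a b : a <= b ->
  (forall x, derivable u x e) -> continuous (fun x => 'D_e u x) ->
  (`|u (p + b *: e) - u (p + a *: e)|%:E <=
   \int[lebesgue_measure]_(s in `[a, b]) `|'D_e u (p + s *: e)|%:E)%E.
Proof.
move=> ab du cu.
have := @ler_dist_integral_derive _ (fun s : R => u (p + s *: e)) _ _ ab.
under eq_integral do rewrite derive_line; apply.
  by move=> s; exact: derivable_line.
rewrite (_ : (fun _ => _) = (fun x => 'D_e u x) \o (fun s => p + s *: e)).
  by move=> s; apply: continuous_comp; [exact: continuous_line|exact: cu].
by apply/funext => s /=; rewrite derive_line.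
Qed.

(** Let [L] be the variation of [f] over the two cells. There [f] stays within [L] of the constant
    [f c], and no constant is close to both targets: [|1 - f c| + |-1 - f c| >= 2]. *)
Lemma sign_step_pair (R : realType) (f : R -> R) (c h : R) : 0 < h ->
  (forall s, derivable f s 1) -> continuous (fun s => 'D_1 f s) ->
  ((2 * h)%:E <=
   \int[lebesgue_measure]_(x in `[c, (c + h)%R[) `|1 - f x|%:E +
   \int[lebesgue_measure]_(x in `[(c + h)%R, (c + 2 * h)%R[) `|-1 - f x|%:E +
   (2 * h)%:E *
     \int[lebesgue_measure]_(x in `[c, (c + 2 * h)%R[) `|'D_1 f x|%:E)%E.
Proof.
move=> h0 df cf.
set L := (X in (_ <= _ + _ * X)%E).
have L0 : (0 <= L)%E by exact: integral_ge0.
have fc : continuous f.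
  by move=> s; apply: differentiable_continuous; exact/derivable1_diffP.
have mf (D : set (measurableTypeR R)) a :
    measurable_fun D (fun x => `|a - f x|%:E).
  apply/measurable_EFinP/measurableT_comp => //; apply: measurable_funTS.
  by apply: measurable_funB => //; exact: continuous_measurable_fun.
have fL x : c <= x < c + 2 * h -> (`|f x - f c|%:E <= L)%E.
  move=> /andP[cx xc]; apply: le_trans (ler_dist_integral_derive cx df cf) _.
  apply: ge0_subset_integral => //.
  - apply/measurable_EFinP/measurableT_comp => //; apply: measurable_funTS.
    exact: continuous_measurable_fun.
  - move=> y /=; rewrite !in_itv/= => /andP[-> yx]; exact: le_lt_trans xc.
(* One cell with target value [z]: replacing [f x] by [f c] costs at most [L] at each point, hence
   [h * L] in the integral. *)
have step a b z : a < b -> b - a = h -> c <= a -> b <= c + 2 * h ->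
    ((h * `|z - f c|)%:E <= \int[lebesgue_measure]_(x in `[a, b[)
      `|z - f x|%:E + h%:E * L)%E.
  move=> ab bah ca bc.
  have mu_ab : lebesgue_measure `[a, b[%classic = h%:E.
    by rewrite lebesgue_measure_itv/= lte_fin ab -EFinB bah.
  rewrite mulrC EFinM -mu_ab -integral_cst//.
  rewrite [X in (_ <= _ + X)%E]muleC -integral_cst//.
  rewrite -ge0_integralD//.
  apply: ge0_le_integral => //.
  - by move=> x _; rewrite lee_fin.
  - by apply: emeasurable_funD; [exact: mf|exact: measurable_cst].
  move=> x /=; rewrite in_itv/= => /andP[ax xb].
  apply: le_trans (leeD2l _ (fL x _)); last first.
    by rewrite (le_trans ca ax) (lt_le_trans xb bc).
  by rewrite -EFinD lee_fin -[z - f c](subrKA (f x)) ler_normD.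
have s1 := step c (c + h) 1.
have s2 := step (c + h) (c + 2 * h) (-1).
have hh : h + h = 2 * h by ring.
have {}s1 : ((h * `|1 - f c|)%:E <= \int[lebesgue_measure]_(x in `[c, (c + h)%R[)
      `|1 - f x|%:E + h%:E * L)%E by apply: s1; lra.
have {}s2 : ((h * `|-1 - f c|)%:E <=
    \int[lebesgue_measure]_(x in `[(c + h)%R, (c + 2 * h)%R[)
      `|-1 - f x|%:E + h%:E * L)%E by apply: s2; lra.
have LL : (h%:E * L + h%:E * L = (2 * h)%:E * L)%E.
  by rewrite -hh EFinD ge0_muleDl ?lee_fin ?ltW.
apply: le_trans (_ : _ <= (h * `|1 - f c|)%:E + (h * `|-1 - f c|)%:E)%E _.
  rewrite -EFinD lee_fin -mulrDr mulrC ler_pM2l//.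
  have := ler_normB (1 - f c) (-1 - f c).
  by rewrite (_ : _ - _ = 2) ?normr_nat//; ring.
by apply: le_trans (leeD s1 s2) _; rewrite addeACA LL.
Qed.

Lemma ge0_integral_itv_split (R : realType) (g : R -> \bar R) (a b c : R) :
  a <= b -> b <= c -> measurable_fun setT g -> (forall x, 0 <= g x)%E ->
  (\int[lebesgue_measure]_(x in `[a, c[) g x =
   \int[lebesgue_measure]_(x in `[a, b[) g x +
   \int[lebesgue_measure]_(x in `[b, c[) g x)%E.
Proof.
move=> ab bc mg g0; rewrite -ge0_integral_setU//=.
- by rewrite -itv_bndbnd_setU// bnd_simp.
- by apply: measurable_funTS.
- apply/disj_setPLR => x/= xab; apply/negP; move: xab.
  by rewrite !in_itv/= => /andP[_ xb]; rewrite negb_and -ltNge xb.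
Qed.

(** Adds up [sign_step_pair] over [p] successive pairs of cells, a cell with [r = 1] followed by one
    with [r = -1]. *)
Lemma sign_step_itv (R : realType) (r f : R -> R) (h : R) (p : nat) : 0 < h ->
  measurable_fun setT r ->
  (forall (i : nat) x, (i < 2 * p)%N -> i%:R * h <= x < i.+1%:R * h ->
    r x = (-1) ^+ i) ->
  (forall s, derivable f s 1) -> continuous (fun s => 'D_1 f s) ->
  ((2 * h * p%:R)%:E <=
   \int[lebesgue_measure]_(x in `[0%R, (2 * h * p%:R)%R[) `|r x - f x|%:E +
   (2 * h)%:E *
     \int[lebesgue_measure]_(x in `[0%R, (2 * h * p%:R)%R[) `|'D_1 f x|%:E)%E.
Proof.
move=> h0 mr rE df cf.
have fc : continuous f.
  by move=> s; apply: differentiable_continuous; exact/derivable1_diffP.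
have mrf : measurable_fun setT (fun x => `|r x - f x|%:E).
  apply/measurable_EFinP/measurableT_comp => //.
  by apply: measurable_funB => //; exact: continuous_measurable_fun.
have mdf : measurable_fun setT (fun x => `|'D_1 f x|%:E).
  apply/measurable_EFinP/measurableT_comp => //.
  exact: continuous_measurable_fun.
suff : forall k, (k <= p)%N -> ((2 * h * k%:R)%:E <=
   \int[lebesgue_measure]_(x in `[0%R, (2 * h * k%:R)%R[) `|r x - f x|%:E +
   (2 * h)%:E *
     \int[lebesgue_measure]_(x in `[0%R, (2 * h * k%:R)%R[) `|'D_1 f x|%:E)%E.
  by apply.
elim=> [_|k ih kp].
  rewrite mulr0; apply: adde_ge0; first exact: integral_ge0.
  by apply: mule_ge0; [rewrite lee_fin mulr_ge0// ltW|exact: integral_ge0].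
have hk0 : 0 <= 2 * h * k%:R by rewrite !mulr_ge0// ltW.
set c := 2 * h * k%:R.
have ck : 2 * h * k.+1%:R = c + 2 * h by rewrite /c -[k.+1%:R]natr1 mulrDr mulr1.
have := leeD (ih (ltnW kp)) (@sign_step_pair _ f c h h0 df cf).
rewrite -/c -EFinD -ck => H; apply: (le_trans H).
have cc : c <= 2 * h * k.+1%:R by rewrite ck lerDl mulr_ge0// ltW.
have ch : c + h <= 2 * h * k.+1%:R by rewrite ck; lra.
have cch : c <= c + h by lra.
rewrite (@ge0_integral_itv_split _ (fun x => `|r x - f x|%:E) 0 c
  (2 * h * k.+1%:R))//.
rewrite (@ge0_integral_itv_split _ (fun x => `|r x - f x|%:E) c (c + h)
  (2 * h * k.+1%:R))//.
rewrite (@ge0_integral_itv_split _ (fun x => `|'D_1 f x|%:E) 0 c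
  (2 * h * k.+1%:R))//.
have I0 a b : (0 <= \int[lebesgue_measure]_(x in `[a, b[) `|'D_1 f x|%:E)%E.
  exact: integral_ge0.
rewrite (ge0_muleDr _ (I0 0 c) (I0 c _)).
rewrite addeACA le_eqVlt; apply/orP; left; apply/eqP.
congr ((_ + (_ + _)) + _)%E.
  apply: eq_integral => x; rewrite inE/= in_itv/= => xc.
  rewrite (rE (2 * k)%N); first by rewrite exprM sqrrN expr1n expr1n.
    by rewrite ltn_pmul2l.
  by move: xc; rewrite /c -[(2 * k).+1]addn1 natrD natrM; lra.
apply: eq_integral => x; rewrite inE/= in_itv/= => xc.
rewrite (rE (2 * k).+1%N).
- by rewrite exprS exprM sqrrN expr1n expr1n mulr1.
- by have := leq_mul (leqnn 2) kp; rewrite mulnS.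
have -> : (2 * k).+1%:R = 2 * k%:R + 1 :> R by rewrite -addn1 natrD natrM.
have -> : (2 * k).+2%:R = 2 * k%:R + 2 :> R by rewrite -addn2 natrD natrM.
by move: xc; rewrite ck /c; lra.
Qed.

(** * Strips of the unit cube *)

Definition unit_cube (R : realType) d : set 'rV[R]_d :=
  [set y | forall i, `[0, 1[%classic (y 0 i)].

Definition strip (R : realType) d (a b : R) : set 'rV[R]_d.+1 :=
  [set x | forall i, (if i == ord0 then `[a, b[%classic else `[0, 1[%classic)
     (x 0 i)].

Lemma measurable_unit_cube (R : realType) d : measurable (@unit_cube R d).
Proof. by apply: (@measurable_box _ _ (fun=> `[0, 1[%classic)) => i. Qed.

Lemma measurable_strip (R : realType) d (a b : R) : measurable (@strip R d a b).
Proof.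
apply: (@measurable_box _ _ (fun i => if i == ord0 then `[a, b[%classic
  else `[0, 1[%classic)) => i.
by case: ifP => _; exact: measurable_itv.
Qed.

Lemma lebesgue_unit_cube (R : realType) d :
  (lebesgue_rV R d (@unit_cube R d) = 1)%E.
Proof.
rewrite (@lebesgue_rV_box _ _ (fun=> `[0, 1[%classic))//.
rewrite big1// => i _.
by rewrite lebesgue_measure_itv/= lte_fin ltr01 sube0.
Qed.

Lemma lebesgue_strip (R : realType) d (a b : R) : a <= b ->
  (lebesgue_rV R d.+1 (strip a b) = (b - a)%:E)%E.
Proof.
move=> ab; rewrite (@lebesgue_rV_box _ _ (fun i => if i == ord0 then `[a, b[%classic
  else `[0, 1[%classic)); last first.
  by move=> i; case: ifP => _; exact: measurable_itv.
rewrite big_ord_recl/= big1 => [|i _].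
  rewrite mule1 lebesgue_measure_itv/= lte_fin; move: ab.
  by rewrite le_eqVlt => /predU1P[->|->]; rewrite ?ltxx ?subrr ?EFinB.
by rewrite lebesgue_measure_itv/= lte_fin ltr01 sube0.
Qed.

Lemma strip_row_cons (R : realType) d (a b x1 : R) (y : 'rV[R]_d) :
  strip a b (row_cons (x1, y)) <-> `[a, b[%classic x1 /\ unit_cube y.
Proof.
split=> [h|[x1ab cy] i].
  split; first by have := h ord0; rewrite mxE unlift_none.
  by move=> i; have := h (lift ord0 i); rewrite mxE liftK.
by rewrite mxE; case: (unliftP ord0 i) => [j ->|->]; [exact: cy|exact: x1ab].
Qed.

Lemma row_cons_line (R : realType) d (x1 : R) (y : 'rV[R]_d) :
  row_cons (x1, y) = row_cons (0, y) + x1 *: delta_mx 0 ord0.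
Proof.
apply/rowP => i; rewrite !mxE eqxx/=.
case: (unliftP ord0 i) => [j ->|->] /=; last by rewrite add0r mulr1.
by rewrite mulr0 addr0.
Qed.

(** This is [sign_step_itv] on every line parallel to the first axis, integrated over the unit cube
    of the other coordinates. The factor [h] says that a good approximation of a fine oscillation
    has a large derivative. *)
Lemma sign_step_strip (R : realType) d (r : R -> R) (w : 'rV[R]_d.+1 -> R)
    (h : R) (p : nat) : 0 < h -> 2 * h * p%:R = 1 ->
  measurable_fun setT r ->
  (forall (i : nat) x, (i < 2 * p)%N -> i%:R * h <= x < i.+1%:R * h ->
    r x = (-1) ^+ i) ->
  continuous w -> (forall x, derivable w x (delta_mx 0 ord0)) ->
  continuous (partial ord0 w) ->
  (1 <= \int[lebesgue_rV R d.+1]_(x in strip 0 1)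
    (`|r (x 0 ord0) - w x|%:E + (2 * h)%:E * `|partial ord0 w x|%:E))%E.
Proof.
move=> h0 hp mr rE cw dw cdw.
pose H (x : 'rV[R]_d.+1) : \bar R := (`|r (x 0 ord0) - w x|%:E +
  (2 * h)%:E * `|partial ord0 w x|%:E)%E.
change (1 <= \int[lebesgue_rV R d.+1]_(x in strip 0 1) H x)%E.
have H0 x : (0 <= H x)%E.
  by rewrite /H -EFinM -EFinD lee_fin addr_ge0// !mulr_ge0// ltW.
have mH : measurable_fun setT H.
  apply: emeasurable_funD.
    apply/measurable_EFinP/measurableT_comp => //; apply: measurable_funB.
      exact: (measurableT_comp mr (measurable_coord (R := R) (n := d.+1) ord0)).
    exact: continuous_measurable_rV.
  apply: measurable_funeM; apply/measurable_EFinP/measurableT_comp => //.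
  exact: continuous_measurable_rV.
have mHs : measurable_fun setT (H \_ (strip 0 1)).
  apply/(measurable_restrictT H); first exact: measurable_strip.
  exact: measurable_funTS.
have Hs0 : forall x, (0 <= (H \_ (strip 0 1)) x)%E by exact: erestrict_ge0.
rewrite integral_mkcond lebesgue_rV_integral_cons_swap//.
(* The constant 1 becomes the integral of 1 over the unit cube, to be compared line by line. *)
rewrite -(lebesgue_unit_cube R d) -[leLHS]mul1e.
rewrite -integral_cst//; last exact: measurable_unit_cube.
rewrite integral_mkcond; apply: ge0_le_integral => //.
- by move=> y _; exact: erestrict_ge0.
- apply/(measurable_restrictT (cst 1%E)); first exact: measurable_unit_cube.
  exact: measurable_cst.
- exact: measurable_integral_row_cons.
move=> y _; rewrite patchE; case: ifPn => [/set_mem cy|_]; last first.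
  by apply: integral_ge0 => x1 _; exact: Hs0.
rewrite (_ : (\int[_]__ _ = \int[lebesgue_measure]_(x1 in `[0%R, 1%R[)
    H (row_cons (x1, y)))%E); last first.
  rewrite [RHS]integral_mkcond; apply: eq_integral => x1 _.
  rewrite !patchE; congr (if _ then _ else _).
  apply/idP/idP => [/set_mem/strip_row_cons[x101 _]|/set_mem x101].
    exact: mem_set.
  by apply: mem_set; apply/strip_row_cons.
have := @sign_step_itv R r (fun x1 => w (row_cons (x1, y))) h p h0 mr rE.
rewrite hp => S.
have wE : (fun x1 => w (row_cons (x1, y))) =
    (fun s : R => w (row_cons (0, y) + s *: delta_mx 0 ord0)).
  by apply/funext => s; rewrite row_cons_line.
have E x1 : 'D_1 (fun x1 => w (row_cons (x1, y))) x1 =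
    partial ord0 w (row_cons (x1, y)).
  by rewrite wE derive_line -row_cons_line.
apply: le_trans (S _ _) _.
- by move=> s; rewrite wE; apply: derivable_line; exact: dw.
- suff -> : (fun x1 => 'D_1 (fun x1 => w (row_cons (x1, y))) x1) =
      partial ord0 w \o (fun s => row_cons (0, y) + s *: delta_mx 0 ord0).
    by move=> s; apply: continuous_comp; [exact: continuous_line|exact: cdw].
  by apply/funext => x1; rewrite E /= row_cons_line.
have mr1 : measurable_fun (`[0, 1[%classic : set R)
    (fun x1 => `|r x1 - w (row_cons (x1, y))|%:E).
  apply: measurable_funTS; apply/measurable_EFinP/measurableT_comp => //.
  apply: measurable_funB => //.
  apply: measurableT_comp (continuous_measurable_rV cw) _.
  apply: measurableT_comp (measurable_row_cons (R := R) (d := d)) _.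
  exact: pair2_measurable.
have mr2 : measurable_fun (`[0, 1[%classic : set R)
    (fun x1 => `|partial ord0 w (row_cons (x1, y))|%:E).
  apply: measurable_funTS; apply/measurable_EFinP/measurableT_comp => //.
  apply: measurableT_comp (continuous_measurable_rV cdw) _.
  apply: measurableT_comp (measurable_row_cons (R := R) (d := d)) _.
  exact: pair2_measurable.
under [X in (_ + _ * X)%E]eq_integral do rewrite E.
rewrite -ge0_integralZl//; last by rewrite lee_fin mulr_ge0// ltW.
rewrite -ge0_integralD//; last 2 first.
- by move=> x1 _; rewrite -EFinM lee_fin !mulr_ge0// ltW.
- exact: measurable_funeM.
rewrite le_eqVlt; apply/orP; left; apply/eqP; apply: eq_integral => x1 _.
by rewrite /H mxE unlift_none.
Qed.

(** * Boundary layers and their horizontal slices *)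

Definition slab (R : realType) d (T : R) : set 'rV[R]_d.+1 :=
  half_space `&` [set z | z 0 ord_max < T].

Lemma slabE (R : realType) d (T : R) :
  @slab R d T = [set z | `]0, T[%classic (z 0 ord_max)].
Proof.
rewrite /slab half_spaceE; apply/seteqP; split=> z /=; rewrite in_itv/=.
  by move=> [-> ->].
by move=> /andP[-> ->].
Qed.

Lemma measurable_slab (R : realType) d (T : R) : measurable (@slab R d T).
Proof.
rewrite slabE; have := @measurable_coord R d.+1 ord_max measurableT.
by move=> /(_ _ (measurable_itv `]0, T[)); rewrite setTI.
Qed.

Lemma measurable_half_space (R : realType) d : measurable (@half_space R d.+1).
Proof.
rewrite half_spaceE; have := @measurable_coord R d.+1 ord_max measurableT.
move=> /(_ _ (measurable_itv `]0, +oo[)); rewrite setTI.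
congr measurable; apply/seteqP; split=> x /=; rewrite in_itv/= andbT//.
Qed.

Lemma lebesgue_rV_integral_snoc_swap (R : realType) d
    (g : 'rV[R]_d.+1 -> \bar R) :
  measurable_fun setT g -> (forall x, 0 <= g x)%E ->
  (\int[lebesgue_rV R d.+1]_x g x =
   \int[lebesgue_measure]_t \int[lebesgue_rV R d]_x g (row_snoc x t))%E.
Proof.
move=> mg g0; rewrite lebesgue_rV_integral_snoc//.
apply: (@fubini_tonelli _ _ _ _ _ (lebesgue_rV R d) lebesgue_measure
  (fun p : 'rV[R]_d * measurableTypeR R => g (row_snoc p.1 p.2))) => //.
exact: measurableT_comp mg (measurable_row_snoc (R := R) (d := d)).
Qed.

Lemma measurable_integral_row_snoc_swap (R : realType) d
    (g : 'rV[R]_d.+1 -> \bar R) :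
  measurable_fun setT g -> (forall x, 0 <= g x)%E ->
  measurable_fun setT
    (fun t : measurableTypeR R => \int[lebesgue_rV R d]_x g (row_snoc x t))%E.
Proof.
move=> mg g0.
apply: (measurable_fun_fubini_tonelli_G
  (fun p : 'rV[R]_d * measurableTypeR R => g (row_snoc p.1 p.2))) => //.
exact: measurableT_comp mg (measurable_row_snoc (R := R) (d := d)).
Qed.

Lemma measurable_restrict_slab (R : realType) d (T : R)
    (F : 'rV[R]_d.+1 -> \bar R) :
  measurable_fun setT F -> measurable_fun setT (F \_ (slab T)).
Proof.
move=> mF; apply/(measurable_restrictT F); first exact: measurable_slab.
exact: measurable_funTS.
Qed.

Lemma restrict_slab_row_snoc (R : realType) d (T t : R)
    (F : 'rV[R]_d.+1 -> \bar R) x :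
  ((F \_ (slab T)) (row_snoc x t) =
   ((fun t => F (row_snoc x t)) \_ `]0%R, T[) t)%E.
Proof.
rewrite !patchE slabE; congr (if _ then _ else _).
by apply/idP/idP => /set_mem /= h; apply: mem_set => /=; move: h;
  rewrite row_snoc_last.
Qed.

Lemma integral_slab (R : realType) d (T : R) (F : 'rV[R]_d.+1 -> \bar R) :
  measurable_fun setT F -> (forall x, 0 <= F x)%E ->
  (\int[lebesgue_rV R d.+1]_(z in slab T) F z =
   \int[lebesgue_rV R d]_x
     \int[lebesgue_measure]_(t in `]0%R, T[) F (row_snoc x t))%E.
Proof.
move=> mF F0; rewrite integral_mkcond lebesgue_rV_integral_snoc; last 2 first.
- exact: measurable_restrict_slab.
- exact: erestrict_ge0.
apply: eq_integral => x _; rewrite [RHS]integral_mkcond.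
by apply: eq_integral => t _; rewrite restrict_slab_row_snoc.
Qed.

Lemma integral_slab_swap (R : realType) d (T : R) (F : 'rV[R]_d.+1 -> \bar R) :
  measurable_fun setT F -> (forall x, 0 <= F x)%E ->
  (\int[lebesgue_rV R d.+1]_(z in slab T) F z =
   \int[lebesgue_measure]_(t in `]0%R, T[)
     \int[lebesgue_rV R d]_x F (row_snoc x t))%E.
Proof.
move=> mF F0.
rewrite integral_mkcond lebesgue_rV_integral_snoc_swap; last 2 first.
- exact: measurable_restrict_slab.
- exact: erestrict_ge0.
rewrite [RHS]integral_mkcond; apply: eq_integral => t _.
rewrite [RHS]patchE; under eq_integral do rewrite restrict_slab_row_snoc patchE.
by case: ifPn => // _; rewrite integral0.
Qed.

(** A slice has dimension at least 1, so its first coordinate is not the appended one; hence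
    derivatives along the first axis can be taken inside a slice. *)
Lemma row_snoc_translate (R : realType) d (x : 'rV[R]_d.+1) (t h : R) :
  row_snoc (h *: delta_mx 0 ord0 + x) t = h *: delta_mx 0 ord0 + row_snoc x t.
Proof.
apply/rowP => i; rewrite [RHS]mxE !row_snocE.
case: insubP => /= [j _ ji|]; first by rewrite !mxE !eqxx/= -!val_eqE/= ji.
rewrite -leqNgt => di; rewrite !mxE eqxx/=.
rewrite (_ : i == ord0 = false) ?mulr0 ?add0r//; apply/negbTE.
by rewrite -val_eqE/= -lt0n (leq_trans _ di).
Qed.

Lemma slice_quotient (R : realType) d (v : 'rV[R]_d.+2 -> R) (t : R) x :
  (fun h : R => h^-1 *: (((fun x => v (row_snoc x t)) \o shift x)
     (h *: (delta_mx 0 ord0 : 'rV[R]_d.+1)) - v (row_snoc x t))) =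
  (fun h : R => h^-1 *: ((v \o shift (row_snoc x t))
     (h *: (delta_mx 0 ord0 : 'rV[R]_d.+2)) - v (row_snoc x t))).
Proof. by apply/funext => h /=; rewrite row_snoc_translate. Qed.

Lemma partial_slice (R : realType) d (v : 'rV[R]_d.+2 -> R) (t : R) x :
  partial ord0 (fun x => v (row_snoc x t)) x = partial ord0 v (row_snoc x t).
Proof. by rewrite /partial /derive slice_quotient. Qed.

Lemma derivable_slice (R : realType) d (v : 'rV[R]_d.+2 -> R) (t : R) x :
  derivable v (row_snoc x t) (delta_mx 0 ord0) ->
  derivable (fun x => v (row_snoc x t)) x (delta_mx 0 ord0).
Proof. by rewrite /derivable slice_quotient. Qed.

Lemma continuous_row_snoc (R : realType) d (t : R) :
  continuous (fun x : 'rV[R]_d => row_snoc x t).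
Proof.
move=> x A [P Px PA].
suff : \forall y \near x, forall i j, P i j (row_snoc y t i j).
  by apply: filterS => y; exact: PA.
have FF : Filter (nbhs x) := nbhs_filter x.
apply: (@filter_forall _ _ _ _ FF) => i.
apply: (@filter_forall _ _ _ _ FF) => j.
have := Px i j; rewrite ord1 row_snocE => Pj.
suff : \forall y \near x, P 0 j (oapp ((y : 'rV[R]_d) 0) t (insub (j : nat))).
  by apply: filterS => y; rewrite row_snocE.
move: Pj; case: insubP => /= [l _ _|_]; first exact: coord_continuous.
by move/nbhs_singleton => Pt; exact: filterE.
Qed.

Lemma continuous_comp_row_snoc (R : realType) d (t : R) (f : 'rV[R]_d.+1 -> R) :
  continuous f -> continuous (fun x : 'rV[R]_d => f (row_snoc x t)).
Proof.
by move=> cf x; apply: continuous_comp; [exact: continuous_row_snoc|exact: cf].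
Qed.

Lemma continuous_comp_boundary (R : realType) d (f : 'rV[R]_d.+1 -> R) :
  continuous f -> continuous (fun x : 'rV[R]_d => f (@boundary R d.+1 x)).
Proof.
rewrite (_ : (fun _ => _) = fun x : 'rV[R]_d => f (row_snoc x 0)).
  exact: continuous_comp_row_snoc.
by apply/funext => x; rewrite row_snoc0.
Qed.

(** At each height [t] in []0, T[] the slice of [v] differs in L^1 from the boundary values by at
    most the mass of the normal derivative in the layer, so [sign_step_strip] bounds its tangential
    derivative from below. Integrating over [t] yields the factor [T] and the integral over the
    layer. *)
Lemma boundary_oscillation (R : realType) d (r : R -> R) (v : 'rV[R]_d.+2 -> R)
    (h T : R) (p : nat) : 0 < h -> 2 * h * p%:R = 1 -> 0 < T ->
  measurable_fun setT r ->
  (forall (i : nat) x, (i < 2 * p)%N -> i%:R * h <= x < i.+1%:R * h ->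
    r x = (-1) ^+ i) ->
  smooth v ->
  (T%:E <=
   T%:E * (\int[lebesgue_rV R d.+1]_(x in strip 0 1)
             `|r (x 0 ord0) - v (@boundary R d.+2 x)|%:E +
           \int[lebesgue_rV R d.+2]_(z in slab T) `|partial ord_max v z|%:E) +
   (2 * h)%:E *
     \int[lebesgue_rV R d.+2]_(z in slab T) `|partial ord0 v z|%:E)%E.
Proof.
move=> h0 hp T0 mr rE sv.
have cv : continuous v by exact: (sv [::]).1.
have cn : continuous (partial ord_max v) by exact: (sv [:: ord_max]).1.
have c0 : continuous (partial ord0 v) by exact: (sv [:: ord0]).1.
pose A (x : 'rV[R]_d.+1) : \bar R := `|r (x 0 ord0) - v (@boundary R d.+2 x)|%:E.
pose N (z : 'rV[R]_d.+2) : \bar R := `|partial ord_max v z|%:E.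
pose B (z : 'rV[R]_d.+2) : \bar R := `|partial ord0 v z|%:E.
(* The mass of the normal derivative on the vertical segment above [x]; it bounds the change of [v]
   from the boundary to any height below [T]. *)
pose G (x : 'rV[R]_d.+1) : \bar R :=
  (\int[lebesgue_measure]_(s in `]0%R, T[) N (row_snoc x s))%E.
have A0 x : (0 <= A x)%E by rewrite lee_fin.
have N0 x : (0 <= N x)%E by rewrite lee_fin.
have B0 x : (0 <= B x)%E by rewrite lee_fin.
have mN : measurable_fun setT N.
  by apply/measurable_EFinP/measurableT_comp => //; exact: continuous_measurable_rV.
have mB : measurable_fun setT B.
  by apply/measurable_EFinP/measurableT_comp => //; exact: continuous_measurable_rV.
have cslice t (f : 'rV[R]_d.+2 -> R) : continuous f ->
    continuous (fun x : 'rV[R]_d.+1 => f (row_snoc x t)).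
  exact: continuous_comp_row_snoc.
have mrc : measurable_fun setT (fun x : 'rV[R]_d.+1 => r (x 0 ord0)).
  exact: (measurableT_comp mr (measurable_coord (R := R) (n := d.+1) ord0)).
have mA : measurable_fun setT A.
  apply/measurable_EFinP/measurableT_comp => //; apply: measurable_funB.
    exact: mrc.
  by apply: continuous_measurable_rV; exact: continuous_comp_boundary.
have G0 x : (0 <= G x)%E by exact: integral_ge0.
have mG : measurable_fun setT G.
  rewrite (_ : G = fun x =>
    (\int[lebesgue_measure]_s (N \_ (slab T)) (row_snoc x s))%E).
    apply: measurable_integral_row_snoc; first exact: measurable_restrict_slab.
    exact: erestrict_ge0.
  apply/funext => x; rewrite /G integral_mkcond.
  by apply: eq_integral => s _; rewrite restrict_slab_row_snoc.
have mNx x : measurable_fun setT (fun s : measurableTypeR R => N (row_snoc x s)).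
  apply: measurableT_comp mN _.
  apply: (measurableT_comp (measurable_row_snoc (R := R) (d := d.+1))
    (pair1_measurable x)).
have mS : measurable (@strip R d 0 1) by exact: measurable_strip.
have hp0 : 0 <= 2 * h by rewrite mulr_ge0// ltW.
have mBt t : measurable_fun setT (fun x : 'rV[R]_d.+1 => B (row_snoc x t)).
  apply/measurable_EFinP/measurableT_comp => //.
  by apply: continuous_measurable_rV; exact: cslice.
pose K : \bar R := (\int[lebesgue_rV R d.+1]_(x in strip 0 1) A x +
  \int[lebesgue_rV R d.+2]_(z in slab T) N z)%E.
pose Gamma t : \bar R := (\int[lebesgue_rV R d.+1]_x B (row_snoc x t))%E.
have Gamma0 t : (0 <= Gamma t)%E by exact: integral_ge0.
have K0 : (0 <= K)%E by apply: adde_ge0; exact: integral_ge0.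
have key t : 0 < t < T -> (1 <= K + (2 * h)%:E * Gamma t)%E.
  move=> /andP[t0 tT].
  have := @sign_step_strip R d r (fun x => v (row_snoc x t)) h p h0 hp mr rE
    (cslice t v cv).
  have dw x :
      derivable (fun x : 'rV[R]_d.+1 => v (row_snoc x t)) x (delta_mx 0 ord0).
    by apply: derivable_slice; exact: (sv [::]).2.
  move=> /(_ dw).
  have -> : partial ord0 (fun x : 'rV[R]_d.+1 => v (row_snoc x t)) =
      fun x => partial ord0 v (row_snoc x t).
    by apply/funext => x; exact: partial_slice.
  move=> /(_ (cslice t _ c0)) S; apply: (le_trans S).
  rewrite /K integral_slab// /Gamma.
  apply: le_trans (_ : _ <= \int[lebesgue_rV R d.+1]_(x in strip 0 1)
     (A x + G x + (2 * h)%:E * B (row_snoc x t)))%E _.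
    apply: ge0_le_integral => //.
    - by move=> x _; rewrite -EFinM -EFinD lee_fin addr_ge0// mulr_ge0.
    - apply: measurable_funTS; apply: emeasurable_funD.
        apply/measurable_EFinP/measurableT_comp => //.
        apply: measurable_funB; first exact: mrc.
        by apply: continuous_measurable_rV; exact: cslice.
      exact: measurable_funeM (mBt t).
    - apply: measurable_funTS; apply: emeasurable_funD.
        exact: emeasurable_funD.
      exact: measurable_funeM.
    move=> x _; apply: leeD2r.
    apply: le_trans (_ : _ <= A x +
      `|v (row_snoc x t) - v (row_snoc x 0)|%:E)%E _.
      rewrite -EFinD lee_fin row_snoc0 [`|v _ - _|]distrC.
      by rewrite -[r _ - _](subrKA (v (@boundary R d.+2 x))) ler_normD.
    apply: leeD2l.
    have := @ler_dist_integral_line R _ v (@boundary R d.+2 x)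
      (delta_mx 0 ord_max) 0 t (ltW t0) ((sv [::]).2 ord_max) cn.
    (* The endpoints of [[0, t]] are null, and []0, t[] lies in []0, T[]. *)
    move/le_trans; apply; rewrite integral_itv_bndoo; last first.
      apply: measurable_funTS; exact: mNx.
    apply: ge0_subset_integral => //.
    - apply: measurable_funTS; exact: mNx.
    - by move=> y /=; rewrite !in_itv/= => /andP[-> yx]; exact: lt_trans tT.
  rewrite ge0_integralD//; last 4 first.
  - by move=> x _; apply: adde_ge0.
  - by apply: measurable_funTS; exact: emeasurable_funD.
  - by move=> x _; rewrite mule_ge0.
  - by apply: measurable_funTS; exact: measurable_funeM (mBt t).
  rewrite ge0_integralD//; last 2 first.
  - exact: measurable_funTS.
  - exact: measurable_funTS.
  apply: leeD.
    apply: leeD2l; exact: ge0_subset_integral.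
  rewrite ge0_integralZl//; last by apply: measurable_funTS; exact: mBt.
  apply: lee_wpmul2l; first by rewrite lee_fin.
  exact: ge0_subset_integral.
have mGamma : measurable_fun (`]0, T[%classic : set (measurableTypeR R)) Gamma.
  by apply: measurable_funTS; exact: measurable_integral_row_snoc_swap.
change (T%:E <= T%:E * K +
  (2 * h)%:E * \int[lebesgue_rV R d.+2]_(z in slab T) B z)%E.
rewrite integral_slab_swap//.
change (T%:E <= T%:E * K +
  (2 * h)%:E * \int[lebesgue_measure]_(t in `]0%R, T[) Gamma t)%E.
have lT : lebesgue_measure (`]0, T[%classic : set R) = T%:E.
  by rewrite lebesgue_measure_itv/= lte_fin T0 sube0.
(* [T] is read as the measure of []0, T[], which turns both constant terms into integrals over the
   heights. *)
rewrite -[X in (X <= _)%E]mul1e muleC -lT [leLHS]muleC.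
rewrite -integral_cst// [X in (_ <= X + _)%E]muleC -integral_cst//.
rewrite -ge0_integralZl//.
rewrite -ge0_integralD//; last 2 first.
- by move=> t _; rewrite mule_ge0.
- exact: measurable_funeM.
apply: ge0_le_integral => //.
by apply: emeasurable_funD => //; exact: measurable_funeM.
Qed.

(** * Integrable functions on the boundary *)

(** An element of [L1] is evaluated through a chosen representative, and this choice respects linear
    combinations only almost everywhere. *)
Lemma L1_fun_linear (R : realType) d (T : measurableType d)
    (mu : {measure set T -> \bar R}) (a : R) (f g : L1 mu) :
  (a *: f + g : L1 mu) = (fun x => a * f x + g x) %[ae mu].
Proof.
have -> : a *: f + g = (\pi_(L1 mu) (a *: repr f + repr g))%qT.
  by rewrite -L1_piD reprK.
exact: repr_L1.
Qed.

Lemma L1_fun0 (R : realType) d (T : measurableType d)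
    (mu : {measure set T -> \bar R}) : (0 : L1 mu) = (fun=> 0) %[ae mu].
Proof.
have -> : 0 = (\pi_(L1 mu) 0)%qT.
  by apply: (addrI (\pi_(L1 mu) 0)%qT); rewrite addr0 L1_piD addr0.
exact: repr_L1.
Qed.

Lemma L1_fun_sum (R : realType) d (T : measurableType d)
    (mu : {measure set T -> \bar R}) (a : nat -> R) (f : nat -> L1 mu)
    (g : nat -> T -> R) n :
  (forall i, (f i : T -> R) = g i %[ae mu]) ->
  (\sum_(i < n) a i *: f i : L1 mu) = (fun x => \sum_(i < n) a i * g i x)
    %[ae mu].
Proof.
move=> fg; elim: n => [|n ih].
  rewrite [X in L1_fun X]big_ord0; apply: filterS (L1_fun0 mu) => x fx _.
  by rewrite big_ord0; exact: fx.
rewrite [X in L1_fun X](_ : _ = a n *: f n + \sum_(i < n) a i *: f i); last first.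
  by rewrite big_ord_recr addrC.
have h := L1_fun_linear (a n) (f n) (\sum_(i < n) a i *: f i).
apply: filterS3 h ih (fg n) => x h1 h2 h3 _.
by rewrite h1// h2// h3// big_ord_recr/= addrC.
Qed.

Lemma measurable_L1_fun (R : realType) d (T : measurableType d)
    (mu : {measure set T -> \bar R}) (f : L1 mu) : measurable_fun setT f.
Proof. exact: measurable_funPT. Qed.

Lemma mem_strip (R : realType) d (a b : R) (x : 'rV[R]_d.+1) :
  (x \in strip a b) =
  (a <= x 0 ord0 < b) && `[< forall j, `[0, 1[%classic (x 0 (lift ord0 j)) >].
Proof.
apply/idP/andP => [/set_mem sx|[x0 /asboolP sx]].
  split; first by have := sx ord0.
  by apply/asboolP => j; exact: (sx (lift ord0 j)).
apply: mem_set => i; case: (unliftP ord0 i) => [j ->|->]; last exact: x0.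
exact: sx.
Qed.

Lemma strip_Lfun (R : realType) d (a b : R) :
  (\1_(strip a b) : 'rV[R]_d.+1 -> R) \in Lfun (lebesgue_rV R d.+1) 1.
Proof.
apply/Lfun1_integrable; apply/integrableP; split.
  by apply/measurable_EFinP; apply: measurable_indic; exact: measurable_strip.
under eq_integral do rewrite /= ger0_norm//.
rewrite integral_indic//; last exact: measurable_strip.
rewrite setIT; have [ab|ba] := leP a b.
  by rewrite [ltLHS](lebesgue_strip d ab) ltry.
(* For [b < a] the strip is empty, so [strip_indicator] makes sense for all [a] and [b]. *)
rewrite (_ : strip a b = set0) ?measure0//.
apply/seteqP; split => // x /(_ ord0) /=; rewrite in_itv/= => /andP[ax xb].
by have := lt_trans (le_lt_trans ax xb) ba; rewrite ltxx.
Qed.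

Definition strip_indicator (R : realType) d (a b : R) : L1 (lebesgue_rV R d.+1) :=
  (\pi_(L1 (lebesgue_rV R d.+1)) (Lfun_Sub (lexx 1%E) (strip_Lfun d a b)))%qT.
Lemma strip_indicatorE (R : realType) d (a b : R) :
  (strip_indicator d a b : 'rV[R]_d.+1 -> R) = \1_(strip a b)
    %[ae lebesgue_rV R d.+1].
Proof. exact: repr_L1. Qed.

Lemma norm_strip_indicator (R : realType) d (a b : R) : a <= b ->
  `|strip_indicator d a b| = b - a.
Proof.
move=> ab; apply: EFin_inj; rewrite -(lebesgue_strip d ab) L1_normE.
transitivity (\int[lebesgue_rV R d.+1]_x (\1_(strip a b) x)%:E)%E; last first.
  by rewrite integral_indic ?setIT//; exact: measurable_strip.
apply: ae_eq_integral => //.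
- by apply/measurable_EFinP; exact: measurableT_comp.
- by apply/measurable_EFinP; apply: measurable_indic; exact: measurable_strip.
apply: filterS (strip_indicatorE d a b) => x fx _.
by rewrite fx// ger0_norm.
Qed.

(** The intervals are half-open, so [[a, b[] and [[b, c[] partition [[a, c[] and the indicators add
    up at every point. *)
Lemma strip_indicatorD (R : realType) d (a b c : R) : a <= b -> b <= c ->
  strip_indicator d a b + strip_indicator d b c = strip_indicator d a c.
Proof.
move=> ab bc; rewrite /strip_indicator L1_piD; apply/eqP/L1_eqP.
apply: aeW => x _.
suff : \1_(strip a b) x + \1_(strip b c) x = \1_(strip a c) x :> R by [].
rewrite !indicE !mem_strip; case: asboolP => _; last by rewrite !andbF addr0.
rewrite !andbT; have [xa|ax] := ltP (x 0 ord0) a.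
  by rewrite leNgt (lt_le_trans xa ab)/= addr0.
have [xb|bx] := ltP (x 0 ord0) b; first by rewrite (lt_le_trans xb bc)/= addr0.
by rewrite add0r.
Qed.

Definition sign_step (R : realType) (h : R) (n : nat) (s : R) : R :=
  \sum_(i < n) (-1) ^+ i * \1_(`[i%:R * h, i.+1%:R * h[%classic) s.

Lemma measurable_sign_step (R : realType) (h : R) n :
  measurable_fun setT (sign_step h n).
Proof.
apply: measurable_sum => i; apply: measurable_funM => //.
Qed.

Lemma sign_stepE (R : realType) (h : R) n (i : nat) (s : R) : 0 < h -> (i < n)%N ->
  i%:R * h <= s < i.+1%:R * h -> sign_step h n s = (-1) ^+ i.
Proof.
move=> h0 ni si; rewrite /sign_step (bigD1 (Ordinal ni))//= big1 => [|j ji].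
  by rewrite addr0 indicE mem_set ?mulr1.
rewrite indicE memNset ?mulr0//= in_itv/= => sj; move/eqP: ji; apply.
apply/val_inj/eqP => /=; rewrite eqn_leq; move: si sj => /andP[i1 i2] /andP[j1 j2].
have := le_lt_trans i1 j2; have := le_lt_trans j1 i2.
by rewrite !ltr_pM2r// !ltr_nat !ltnS => -> ->.
Qed.

(** The profile [sign_step] in the first coordinate, cut off by the unit cube in the others, as a
    class in [L1]. *)
Definition sign_strips (R : realType) d (h : R) n : L1 (lebesgue_rV R d.+1) :=
  \sum_(i < n) (-1) ^+ i *: strip_indicator d (i%:R * h) (i.+1%:R * h).

(** On the unit cube the representative of [sign_strips] agrees almost everywhere with the explicit
    profile; the part of the norm off the cube is dropped. Closeness of classes thus bounds an
    integral of explicit functions. *)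
Lemma integral_sign_step_le (R : realType) d (h : R) n
    (f : L1 (lebesgue_rV R d.+1)) (g : 'rV[R]_d.+1 -> R) :
  measurable_fun setT g -> (f : 'rV[R]_d.+1 -> R) = g %[ae lebesgue_rV R d.+1] ->
  (\int[lebesgue_rV R d.+1]_(x in strip 0 1)
     `|sign_step h n (x 0 ord0) - g x|%:E <= `|f - sign_strips d h n|%:E)%E.
Proof.
move=> mg fg; pose w : L1 (lebesgue_rV R d.+1) := f - sign_strips d h n.
rewrite -[X in (_ <= `|X|%:E)%E]/w L1_normE.
have mw : measurable_fun setT w by exact: measurable_L1_fun.
have mS : measurable (@strip R d 0 1) by exact: measurable_strip.
apply: le_trans (_ : _ <= \int[lebesgue_rV R d.+1]_(x in strip 0 1) `|w x|%:E)%E _;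
  last first.
  apply: ge0_subset_integral => //.
  by apply/measurable_EFinP; exact: measurableT_comp.
rewrite le_eqVlt; apply/orP; left; apply/eqP; apply: ae_eq_integral => //.
- apply/measurable_EFinP/measurableT_comp => //; apply: measurable_funTS.
  apply: measurable_funB => //.
  exact: (measurableT_comp (measurable_sign_step h n)
    (measurable_coord (R := R) (n := d.+1) ord0)).
- by apply: measurable_funTS; apply/measurable_EFinP; exact: measurableT_comp.
have wE : w = -1 *: sign_strips d h n + f by rewrite /w scaleN1r addrC.
have h1 := L1_fun_linear (-1) (sign_strips d h n) f.
have h2 := @L1_fun_sum R _ _ (lebesgue_rV R d.+1) (fun i => (-1) ^+ i)
  (fun i => strip_indicator d (i%:R * h) (i.+1%:R * h))
  (fun i => \1_(strip (i%:R * h) (i.+1%:R * h))) n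
  (fun i => strip_indicatorE d (i%:R * h) (i.+1%:R * h)).
rewrite wE; apply: filterS3 h1 h2 fg => x h1 h2 fg /mem_set.
rewrite mem_strip => /andP[x01 /asboolP cx].
rewrite h1// h2// fg// mulN1r [in RHS]addrC [in RHS]distrC; congr (`|_ - _|%:E).
apply: eq_bigr => i _; rewrite !indicE mem_strip; congr (_ * _%:R).
rewrite (_ : `[< _ >] = true) ?andbT; last exact/asboolP.
by rewrite mem_setE in_itv.
Qed.

(** * Mass in a boundary layer *)

Definition sobolev_emb (R : realType) n k (W : sobolev_space R n k)
  (u : 'rV[R]_n -> R) : W := completion_emb W (restrict_half u).

(** [fine] would send an infinite integral to 0; [integral_norm_Dk] excludes this for test functions
    on measurable parts of the half-space. *)
Definition sobolev_mass (R : realType) n k (S : set 'rV[R]_n)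
  (u : 'rV[R]_n -> R) : R :=
  fine (\int[lebesgue_rV R n]_(x in S) (norm_Dk k u x)%:E).

Lemma measurable_norm_Dk (R : realType) n k (u : 'rV[R]_n -> R) :
  smooth u -> measurable_fun setT (fun x => (norm_Dk k u x)%:E).
Proof.
move=> su; apply/measurable_EFinP; rewrite /norm_Dk.
apply: (@measurableT_comp _ _ _ _ _ _ (@Num.sqrt R)).
  by apply: continuous_measurable_fun; exact: sqrt_continuous.
apply: measurable_sum => s; apply: measurable_funX.
exact: continuous_measurable_rV (su s).1.
Qed.

Lemma sobolev_emb_linear (R : realType) n k (W : sobolev_space R n k) (a : R)
    (u v : 'rV[R]_n -> R) : Cc_infty u -> Cc_infty v ->
  sobolev_emb W (fun x => a * u x + v x) =
  a *: sobolev_emb W u + sobolev_emb W v.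
Proof.
move=> cu cv; rewrite /sobolev_emb restrict_half_linear.
by rewrite completion_linear.
Qed.

Lemma sobolev_emb_dense (R : realType) n k (W : sobolev_space R n k) (w : W)
    (e : R) : 0 < e ->
  exists2 u, Cc_infty u & `|sobolev_emb W u - w| < e.
Proof.
move=> e0.
have [||w' [wball [f [u cu uf] fw']]] := @completion_dense _ _ _ _ W (ball w e).
- by exists w; exact: ballxx.
- exact: ball_open.
exists u => //; rewrite /sobolev_emb uf fw' distrC.
by move: wball; rewrite -ball_normE.
Qed.

Lemma Cc_infty_sum (R : realType) n (a : nat -> R) (u : nat -> 'rV[R]_n -> R) m :
  (forall i, (i < m)%N -> Cc_infty (u i)) ->
  Cc_infty (fun x => \sum_(i < m) a i * u i x).
Proof.
elim: m => [_|m ih cu].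
  rewrite (_ : (fun _ => _) = fun=> 0); first exact: Cc_infty0.
  by apply/funext => x; rewrite big_ord0.
rewrite (_ : (fun _ => _) = fun x => a m * u m x + \sum_(i < m) a i * u i x).
  apply: Cc_infty_linear; first exact: cu.
  by apply: ih => i im; apply: cu; rewrite ltnS ltnW.
by apply/funext => x; rewrite big_ord_recr addrC.
Qed.

Lemma sobolev_emb0 (R : realType) n k (W : sobolev_space R n k) :
  sobolev_emb W (fun=> 0) = 0.
Proof.
(* Linearity is given in the form [a * u + v]; taking [a = -1] and [u = v = 0] yields the value at
   0. *)
have := @sobolev_emb_linear _ _ _ W (-1) _ _ (Cc_infty0 R n) (Cc_infty0 R n).
rewrite scaleN1r addNr => <-; congr sobolev_emb.
by apply/funext => x; rewrite mulr0 addr0.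
Qed.

Lemma sobolev_emb_sum (R : realType) n k (W : sobolev_space R n k) (a : nat -> R)
    (u : nat -> 'rV[R]_n -> R) m : (forall i, (i < m)%N -> Cc_infty (u i)) ->
  sobolev_emb W (fun x => \sum_(i < m) a i * u i x) =
  \sum_(i < m) a i *: sobolev_emb W (u i).
Proof.
elim: m => [_|m ih cu].
  rewrite big_ord0 -(sobolev_emb0 W); congr sobolev_emb.
  by apply/funext => x; rewrite big_ord0.
rewrite (_ : (fun _ => _) = fun x => a m * u m x + \sum_(i < m) a i * u i x).
  have cu' i : (i < m)%N -> Cc_infty (u i).
    by move=> im; apply: cu; rewrite ltnS ltnW.
  rewrite sobolev_emb_linear ?ih ?big_ord_recr 1?addrC//; first exact: cu.
  exact: Cc_infty_sum.
by apply/funext => x; rewrite big_ord_recr addrC.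
Qed.

Section sobolev_mass.
Context (R : realType) (d k : nat) (W : sobolev_space R d.+1 k).
Implicit Types (u v : 'rV[R]_d.+1 -> R) (S : set 'rV[R]_d.+1).
Let mu := lebesgue_rV R d.+1.
Notation mass := (sobolev_mass k).

Lemma norm_sobolev_emb u : Cc_infty u ->
  (`|sobolev_emb W u|%:E = \int[mu]_(x in half_space) (norm_Dk k u x)%:E)%E.
Proof.
move=> cu; rewrite completion_norm; last by exists u.
by apply: eq_integral => x /set_mem hx; rewrite norm_Dk_restrict_half.
Qed.

(** Finiteness comes from the completion: over the whole half-space the integral is the norm of an
    element of [W], a real number. *)
Lemma integral_norm_Dk S u : measurable S -> S `<=` half_space -> Cc_infty u ->
  (\int[mu]_(x in S) (norm_Dk k u x)%:E = (mass S u)%:E)%E.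
Proof.
move=> mS Sh cu; rewrite /sobolev_mass fineK// ge0_fin_numE; last first.
  by apply: integral_ge0 => x _; rewrite lee_fin norm_Dk_ge0.
apply: le_lt_trans (ltry `|sobolev_emb W u|); rewrite norm_sobolev_emb//.
apply: ge0_subset_integral => //; first exact: measurable_half_space.
  apply: measurable_funTS; apply: measurable_norm_Dk; exact: cu.1.
by move=> x _; rewrite lee_fin norm_Dk_ge0.
Qed.

Lemma sobolev_mass_ge0 S u : 0 <= mass S u.
Proof.
apply: fine_ge0; apply: integral_ge0 => x _; rewrite lee_fin; exact: norm_Dk_ge0.
Qed.

Lemma sobolev_mass_half u : Cc_infty u -> mass half_space u = `|sobolev_emb W u|.
Proof. by move=> cu; rewrite /sobolev_mass -norm_sobolev_emb. Qed.

Lemma sobolev_mass_le S u : measurable S -> S `<=` half_space -> Cc_infty u ->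
  mass S u <= `|sobolev_emb W u|.
Proof.
move=> mS Sh cu; rewrite -lee_fin -integral_norm_Dk// norm_sobolev_emb//.
apply: ge0_subset_integral => //; first exact: measurable_half_space.
  apply: measurable_funTS; apply: measurable_norm_Dk; exact: cu.1.
by move=> x _; rewrite lee_fin norm_Dk_ge0.
Qed.

Lemma sobolev_massU S S' u : measurable S -> measurable S' ->
  S `<=` half_space -> S' `<=` half_space -> [disjoint S & S'] -> Cc_infty u ->
  mass (S `|` S') u = mass S u + mass S' u.
Proof.
move=> mS mS' Sh Sh' SS' cu; apply: EFin_inj; rewrite EFinD.
rewrite -!integral_norm_Dk//; [|exact: measurableU|by rewrite subUset].
rewrite ge0_integral_setU//.
- apply: measurable_funTS; apply: measurable_norm_Dk; exact: cu.1.
- by move=> x _; rewrite lee_fin norm_Dk_ge0.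
Qed.

Lemma sobolev_mass_linear S (a : R) u v : measurable S -> S `<=` half_space ->
  Cc_infty u -> Cc_infty v ->
  mass S (fun x => a * u x + v x) <= `|a| * mass S u + mass S v.
Proof.
move=> mS Sh cu cv; rewrite -lee_fin EFinD EFinM -!integral_norm_Dk//; last first.
  exact: Cc_infty_linear.
have mD w : Cc_infty w -> measurable_fun S (fun x => (norm_Dk k w x)%:E).
  by move=> cw; apply: measurable_funTS; apply: measurable_norm_Dk; exact: cw.1.
have D0 w x : (0 <= (norm_Dk k w x)%:E)%E by rewrite lee_fin norm_Dk_ge0.
rewrite -ge0_integralZl//; last exact: mD.
rewrite -ge0_integralD//; last 3 first.
- by move=> x _; rewrite mule_ge0.
- by apply: measurable_funeM; exact: mD.
- exact: mD.
apply: ge0_le_integral => //.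
- by apply: mD; exact: Cc_infty_linear.
- by apply: emeasurable_funD; [apply: measurable_funeM|]; exact: mD.
move=> x _; rewrite -EFinM -EFinD lee_fin; apply: norm_Dk_linear.
  exact: cu.1.
exact: cv.1.
Qed.

Lemma sobolev_mass_sum S (a : nat -> R) (u : nat -> 'rV[R]_d.+1 -> R) n :
  measurable S -> S `<=` half_space -> (forall i, (i < n)%N -> Cc_infty (u i)) ->
  mass S (fun x => \sum_(i < n) a i * u i x) <= \sum_(i < n) `|a i| * mass S (u i).
Proof.
move=> mS Sh; elim: n => [_|n ih cu].
  rewrite (_ : (fun _ => _) = fun=> 0); last first.
    by apply/funext => x; rewrite big_ord0.
  by rewrite big_ord0 /sobolev_mass integral0_eq// => x _; rewrite norm_Dk0.
have cu' i : (i < n)%N -> Cc_infty (u i) by move=> /ltnW; exact: cu.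
rewrite (_ : (fun _ => _) = fun x => a n * u n x + \sum_(i < n) a i * u i x).
  rewrite [leRHS]big_ord_recr [leRHS]addrC /=.
  apply: le_trans (sobolev_mass_linear _ _ _ _ _) _ => //.
  - exact: cu.
  - exact: Cc_infty_sum.
  - by rewrite lerD2l; exact: ih.
by apply/funext => x; rewrite big_ord_recr addrC.
Qed.

(** An L^1 norm is additive over a set and its complement. This exact splitting later turns a lower
    bound for the mass away from the boundary into an upper bound for the mass in the layer. *)
Lemma sobolev_mass_slab T u : Cc_infty u ->
  mass (slab T) u + mass (half_space `\` slab T) u = `|sobolev_emb W u|.
Proof.
move=> cu; rewrite -sobolev_mass_half// -sobolev_massU//.
- by rewrite setDUK// => z [].
- exact: measurable_slab.
- apply: measurableD; [exact: measurable_half_space|exact: measurable_slab].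
- by move=> z [].
- by apply/disj_setPS; rewrite setDE setICA setICr setI0.
Qed.

(** The complements of the layers increase to the half-space, so by monotone convergence they
    exhaust the mass. *)
Lemma sobolev_mass_slab_cvg u (e : R) : Cc_infty u -> 0 < e ->
  \forall m \near \oo, mass (slab m.+1%:R^-1) u < e.
Proof.
move=> cu e0.
pose F m : set 'rV[R]_d.+1 := half_space `\` slab m.+1%:R^-1.
have FE m : F m = [set z | m.+1%:R^-1 <= z 0 ord_max].
  rewrite /F slabE half_spaceE; apply/seteqP; split => z /=.
    by rewrite in_itv/= => -[-> /negP]; rewrite -leNgt.
  move=> mz; have z0 : 0 < z 0 ord_max by rewrite (lt_le_trans _ mz)// invr_gt0.
  by split => //; rewrite in_itv/= z0/=; apply/negP; rewrite -leNgt.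
have mF m : measurable (F m).
  apply: measurableD; [exact: measurable_half_space|exact: measurable_slab].
have Fh m : F m `<=` half_space by move=> z [].
have UF : \bigcup_m F m = half_space.
  apply/seteqP; split => z; first by move=> [m _ /Fh].
  rewrite half_spaceE => /= z0.
  have [m _ /(_ m (leqnn m)) mz] := near_infty_natSinv_lt (PosNum z0).
  by exists m => //; rewrite FE /=; exact: ltW.
have D0 x : (0 <= (norm_Dk k u x)%:E)%E by rewrite lee_fin norm_Dk_ge0.
have := @ge0_nondecreasing_set_cvg_integral _ _ _ F
  (fun x => (norm_Dk k u x)%:E) mu.
rewrite UF -norm_sobolev_emb// => H.
have {}H : mass (F m) u @[m --> \oo] --> `|sobolev_emb W u|.
  apply: fine_cvg; apply: H => //.
  - apply/nondecreasing_seqP => m; rewrite subsetEset !FE => z /=.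
    by apply: le_trans; rewrite lef_pV2 ?posrE// ler_nat.
  - move=> m; apply: measurable_funTS; apply: measurable_norm_Dk; exact: cu.1.
have /cvgrPdist_lt /(_ e e0) := H.
apply: filterS => m; rewrite -sobolev_mass_half//.
rewrite sobolev_mass_half// -(sobolev_mass_slab m.+1%:R^-1 cu).
by rewrite addrK ger0_norm// sobolev_mass_ge0.
Qed.

End sobolev_mass.

(** * Variation of an additive interval function over uniform grids *)

Lemma sum_blocks (V : zmodType) (f : nat -> V) m p :
  \sum_(i < m * p) f i = \sum_(j < m) \sum_(l < p) f (j * p + l)%N.
Proof.
elim: m => [|m ih]; first by rewrite mul0n !big_ord0.
rewrite big_ord_recr /= -ih mulSn addnC -!(big_mkord xpredT).
rewrite [LHS](@big_cat_nat _ _ _ (m * p)%N) ?leq_addr//=; congr +%R.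
rewrite -{1}[(m * p)%N]add0n big_addn addKn big_mkord.
by apply: eq_bigr => l _; rewrite addnC.
Qed.

Section additive_interval_function.
Context (R : realType) (V : normedModType R) (g : R -> R -> V) (C : R)
  (gD : forall a b c, a <= b -> b <= c -> g a b + g b c = g a c)
  (gC : forall a b, a <= b -> `|g a b| <= C * (b - a)).

Definition grid_val m (i : nat) : V := g (i%:R / m%:R) (i.+1%:R / m%:R).

Lemma telescope_interval (x : nat -> R) n :
  {homo x : i j / (i <= j)%N >-> i <= j} ->
  \sum_(i < n) g (x i) (x i.+1) = g (x 0%N) (x n).
Proof.
move=> xm; elim: n => [|n ih].
  (* [g] vanishes on a degenerate interval by additivity: [g a a + g a a = g a a]. *)
  rewrite big_ord0; apply: (addrI (g (x 0%N) (x 0%N))).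
  by rewrite addr0 gD.
by rewrite big_ord_recr/= ih gD ?xm.
Qed.

Lemma grid_val_blocks m p j : (0 < m)%N -> (0 < p)%N ->
  grid_val m j = \sum_(l < p) grid_val (m * p) (j * p + l)%N.
Proof.
move=> m0 p0; pose x l : R := (j * p + l)%:R / (m * p)%:R.
have p0' : p%:R != 0 :> R by rewrite pnatr_eq0 -lt0n.
have xE i : (i * p)%:R / (m * p)%:R = i%:R / m%:R :> R.
  by rewrite !natrM invfM mulrACA divff ?mulr1.
have xm : {homo x : i l / (i <= l)%N >-> i <= l}.
  by move=> a b ab; rewrite ler_wpM2r// ler_nat leq_add2l.
rewrite /grid_val -!xE; have := telescope_interval p xm.
rewrite /x addn0 -mulSnr => <-.
by apply: eq_bigr => l _; rewrite addnS.
Qed.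

Lemma norm_grid_val_le m i : (0 < m)%N -> `|grid_val m i| <= C / m%:R.
Proof.
move=> m0; apply: le_trans (gC _) _.
  by rewrite ler_wpM2r// ler_nat.
by rewrite -mulrBl -natrB ?subSnn ?mul1r.
Qed.

(** Every grid sum is at most [C], so the supremum over all grids is finite; a grid within [e] of it
    cannot be surpassed by more than [e], in particular by its refinements. *)
Lemma near_maximal_grid (e : R) : 0 < e -> exists2 m, (0 < m)%N &
  forall p, (0 < p)%N ->
    \sum_(i < m * p) `|grid_val (m * p) i| <= \sum_(i < m) `|grid_val m i| + e.
Proof.
move=> e0; pose A m := \sum_(i < m) `|grid_val m i|.
(* The index [m.+1] leaves out the empty grid. *)
pose S := [set A m.+1 | m in [set: nat]].
have AC m : (0 < m)%N -> A m <= C.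
  move=> m0; apply: le_trans (_ : _ <= \sum_(i < m) C / m%:R) _.
    by apply: ler_sum => i _; exact: norm_grid_val_le.
  by rewrite sumr_const card_ord -[leLHS]mulr_natr divfK// pnatr_eq0 -lt0n.
have supS : has_sup S.
  split; first by exists (A 1%N); exists 0%N.
  by exists C => _ [m _ <-]; exact: AC.
have [_ [m _ <-] mS] := sup_adherent e0 supS.
exists m.+1 => // p p0; rewrite -/(A _) -/(A m.+1).
move: mS; rewrite ltrBlDr => /ltW; apply: le_trans.
apply: sup_upper_bound => //; exists (m.+1 * p).-1 => //.
by rewrite prednK// muln_gt0.
Qed.

End additive_interval_function.

(** [v] is the sum of the [u i] plus a remainder, whose mass in [S] is at most its full norm. *)
Lemma sobolev_mass_sub_le (R : realType) d k (W : sobolev_space R d.+1 k)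
    (S : set 'rV[R]_d.+1) (v : 'rV[R]_d.+1 -> R) (u : nat -> 'rV[R]_d.+1 -> R) n :
  measurable S -> S `<=` half_space -> Cc_infty v -> (forall i, Cc_infty (u i)) ->
  sobolev_mass k S v <= \sum_(i < n) sobolev_mass k S (u i) +
    `|sobolev_emb W v - \sum_(i < n) sobolev_emb W (u i)|.
Proof.
move=> mS Sh cv cu.
pose s x := \sum_(i < n) 1 * u i x.
have cs : Cc_infty s by apply: (@Cc_infty_sum _ _ (fun=> 1)) => i _.
pose r x : R := -1 * s x + v x.
have cr : Cc_infty r by exact: Cc_infty_linear.
have vE : v = fun x => 1 * s x + r x.
  by apply/funext => x; rewrite /r mul1r mulN1r addrA subrr add0r.
rewrite {1}vE; apply: le_trans (sobolev_mass_linear W 1 mS Sh cs cr) _.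
rewrite normr1 mul1r; apply: lerD.
  apply: le_trans (sobolev_mass_sum W (fun=> 1) mS Sh (fun i _ => cu i)) _.
  by apply: ler_sum => i _; rewrite normr1 mul1r.
apply: le_trans (sobolev_mass_le W mS Sh cr) _.
rewrite (sobolev_emb_linear W (-1) cs cv) scaleN1r addrC.
rewrite (@sobolev_emb_sum _ _ _ W (fun=> 1) u n (fun i _ => cu i)).
by under eq_bigr do rewrite scale1r.
Qed.

(* The masses |g| of the cells of finer and finer grids increase to the total
   variation of g, so refining an almost optimal grid moves little mass: the
   approximants of the cells of all finer grids carry as little mass in a thin
   boundary layer as the finitely many approximants on the coarse grid. *)
Lemma uniformly_small_slab_mass (R : realType) d k (W : sobolev_space R d.+1 k)
    (g : R -> R -> W) (C e : R) :
  (forall a b c, a <= b -> b <= c -> g a b + g b c = g a c) ->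
  (forall a b, a <= b -> `|g a b| <= C * (b - a)) -> 0 < e ->
  exists m, exists2 T : R, (0 < m)%N /\ 0 < T & forall p, (0 < p)%N ->
    exists u : nat -> 'rV[R]_d.+1 -> R, [/\ forall i, Cc_infty (u i),
      \sum_(i < m * p) `|sobolev_emb W (u i) - grid_val g (m * p) i| <= e &
      \sum_(i < m * p) sobolev_mass k (slab T) (u i) <= 6 * e].
Proof.
move=> gD gC e0.
have [m m0 mA] := near_maximal_grid gC e0.
(* Each of the [q] cells is approximated within [e / q], so the errors add up to at most [e]. *)
have approx q : (0 < q)%N -> exists u : nat -> 'rV[R]_d.+1 -> R,
    (forall i, Cc_infty (u i)) /\
    \sum_(i < q) `|sobolev_emb W (u i) - grid_val g q i| <= e.
  move=> q0; have q0' : 0 < q%:R :> R by rewrite ltr0n.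
  have /choice[u Hu] (i : nat) : exists u : 'rV[R]_d.+1 -> R, Cc_infty u /\
      `|sobolev_emb W u - grid_val g q i| < e / q%:R.
    have [u cu Hu] := sobolev_emb_dense (grid_val g q i) (divr_gt0 e0 q0').
    by exists u.
  exists u; split=> [i|]; first by have [] := Hu i.
  apply: le_trans (_ : _ <= \sum_(i < q) e / q%:R) _.
    by apply: ler_sum => i _; have [_ /ltW] := Hu i.
  by rewrite sumr_const card_ord -[leLHS]mulr_natr divfK// gt_eqF.
have [U [cU UE]] := approx m m0.
(* Only the [m] coarse approximants enter here, so one layer serves them all, and [T] is fixed
   before [p]. *)
have [T T0 UT] : exists2 T : R, 0 < T &
    \sum_(j < m) sobolev_mass k (slab T) (U j) <= e.
  have m0' : 0 < m%:R :> R by rewrite ltr0n.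
  have : \forall l \near \oo, forall j : 'I_m,
      sobolev_mass k (slab l.+1%:R^-1) (U j) < e / m%:R.
    apply: filter_forall => j; apply: (sobolev_mass_slab_cvg W) => //.
    exact: divr_gt0.
  move=> [l _ /(_ l (leqnn l)) Hl]; exists l.+1%:R^-1; first by rewrite invr_gt0.
  apply: le_trans (_ : _ <= \sum_(i < m) e / m%:R) _.
    by apply: ler_sum => i _; exact/ltW/Hl.
  by rewrite sumr_const card_ord -[leLHS]mulr_natr divfK// gt_eqF.
exists m, T => // p p0.
have mp0 : (0 < m * p)%N by rewrite muln_gt0 m0.
have [u [cu uE]] := approx (m * p)%N mp0.
exists u; split => //.
pose F : set 'rV[R]_d.+1 := half_space `\` slab T.
have mF : measurable F.
  apply: measurableD; [exact: measurable_half_space|exact: measurable_slab].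
have Fh : F `<=` half_space by move=> z [].
pose near := sobolev_mass k (slab T : set 'rV[R]_d.+1).
pose far := sobolev_mass k F.
have nf v : Cc_infty v -> near v + far v = `|sobolev_emb W v|.
  exact: sobolev_mass_slab.
(* A coarse cell is the sum of its [p] fine cells; the coarse and the fine approximation errors
   contribute [e] each. *)
have far_le : \sum_(j < m) far (U j) <= \sum_(i < m * p) far (u i) + 2 * e.
  have step (j : 'I_m) : far (U j) <= \sum_(l < p) far (u (j * p + l)%N) +
      (`|sobolev_emb W (U j) - grid_val g m j| +
       \sum_(l < p) `|sobolev_emb W (u (j * p + l)%N) -
         grid_val g (m * p) (j * p + l)%N|).
    have := @sobolev_mass_sub_le R d k W F (U j) (fun l => u (j * p + l)%N) p
      mF Fh (cU j) (fun l => cu _).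
    move/le_trans; apply; rewrite lerD2l.
    rewrite -[_ - _](subrKA (grid_val g m j)).
    apply: le_trans (ler_normD _ _) _; rewrite lerD2l.
    rewrite (grid_val_blocks gD j m0 p0) distrC -sumrB.
    exact: ler_norm_sum.
  apply: le_trans (ler_sum _ (fun j _ => step j)) _.
  rewrite !big_split/= -(sum_blocks (fun i => far (u i))).
  rewrite -(sum_blocks (fun i => `|sobolev_emb W (u i) - grid_val g (m * p) i|)).
  by rewrite lerD2l mulr_natl mulr2n lerD.
have AU : \sum_(j < m) `|grid_val g m j| <= \sum_(j < m) `|sobolev_emb W (U j)| + e.
  apply: le_trans (_ : _ <= \sum_(j < m) (`|sobolev_emb W (U j)| +
      `|sobolev_emb W (U j) - grid_val g m j|)) _.
    apply: ler_sum => j _; rewrite [X in _ + X]distrC.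
    by rewrite -{1}[grid_val g m j](subrKC (sobolev_emb W (U j))) ler_normD.
  by rewrite big_split/= lerD2l.
have Au : \sum_(i < m * p) `|sobolev_emb W (u i)| <=
    \sum_(i < m * p) `|grid_val g (m * p) i| + e.
  apply: le_trans (_ : _ <= \sum_(i < m * p) (`|grid_val g (m * p) i| +
      `|sobolev_emb W (u i) - grid_val g (m * p) i|)) _.
    apply: ler_sum => j _.
    by rewrite -{1}[sobolev_emb W (u j)](subrKC (grid_val g (m * p) j)) ler_normD.
  by rewrite big_split/= lerD2l.
have nfU : \sum_(j < m) `|sobolev_emb W (U j)| =
    \sum_(j < m) near (U j) + \sum_(j < m) far (U j).
  by rewrite -big_split/=; apply: eq_bigr => j _; rewrite nf.
have nfu : \sum_(i < m * p) `|sobolev_emb W (u i)| =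
    \sum_(i < m * p) near (u i) + \sum_(i < m * p) far (u i).
  by rewrite -big_split/=; apply: eq_bigr => j _; rewrite nf.
(* The count: the fine near mass is the fine total minus the fine far mass. Passing to the coarse
   grid costs [3 * e] in the totals and [2 * e] in the far masses, and the coarse near mass is at
   most [e]. *)
have := mA p p0; rewrite -/near in UT *.
by move: far_le AU Au UT; rewrite nfU nfu; lra.
Qed.

Lemma integral_partials_le (R : realType) d k (W : sobolev_space R d.+1 k)
    (S : set 'rV[R]_d.+1) (u : 'rV[R]_d.+1 -> R) (s : k.-tuple 'I_d.+1) :
  measurable S -> S `<=` half_space -> Cc_infty u ->
  (\int[lebesgue_rV R d.+1]_(x in S) `|partials s u x|%:E <=
   (sobolev_mass k S u)%:E)%E.
Proof.
move=> mS Sh cu; rewrite -(integral_norm_Dk W mS Sh cu).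
apply: ge0_le_integral => //.
- apply/measurable_EFinP/measurableT_comp => //; apply: measurable_funTS.
  exact: continuous_measurable_rV (cu.1 s).1.
- by apply: measurable_funTS; exact: measurable_norm_Dk cu.1.
- by move=> x _; rewrite lee_fin ler_partials_norm_Dk.
Qed.

Lemma smooth_partials (R : realType) n (u : 'rV[R]_n -> R) s :
  smooth u -> smooth (partials s u).
Proof. by move=> su s'; rewrite /partials -foldr_cat; exact: su. Qed.

Lemma continuous_linear_le (R : realType) (V W : normedModType R)
    (f : {linear V -> W}) : continuous f ->
  exists2 C, 0 < C & forall x, `|f x| <= C * `|x|.
Proof.
move=> /linear_bounded_continuous/linear_boundedP fb.
near (pinfty_nbhs R) => C; exists C; near: C => //.
exact: nbhs_pinfty_gt.
Unshelve. all: by end_near. Qed.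

(** * The last component of the trace space *)

Section trace_space_L1.
Context (R : realType) (d k : nat) (B : 'I_k.-1 -> normedModType R).

Definition trace_top (f : L1 (lebesgue_rV R d)) : trace_space d B :=
  TraceSpace (fun=> 0) f.

Lemma trace_top_linear (a : R) f g :
  trace_top (a *: f + g) = a *: trace_top f + trace_top g.
Proof.
apply: trace_space_eq => //=; apply: functional_extensionality_dep => j.
by rewrite scaler0 addr0.
Qed.

Lemma norm_trace_top f : `|trace_top f| = `|f|.
Proof.
rewrite [LHS]/(trace_norm _) /trace_norm big1 ?add0r// => j _.
exact: normr0.
Qed.

Lemma norm_trace_L1_le (t : trace_space d B) : `|trace_L1 t| <= `|t|.
Proof.
rewrite [leRHS]/(trace_norm _) /trace_norm lerDr.
by apply: sumr_ge0 => j _; exact: normr_ge0.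
Qed.

End trace_space_L1.

(** * Contradiction from a rapidly alternating boundary datum *)

Theorem proposition2p5 (R : realType) (n k : nat)
    (n_ge2 : (2 <= n)%N) (k_ge1 : (1 <= k)%N)
    (m : 'I_k.-1 -> nat) (m_gt : forall j : 'I_k.-1, (k.-1 - j < m j)%N)
    (W : sobolev_space R n k)
    (B : forall j : 'I_k.-1, besov_space R n.-1 (k.-1 - j)%N%:R (m j))
    (tr : {linear W -> trace_space n.-1 B})
    (tr_continuous : continuous tr) (tr_extends : extends_trace tr) :
  ~ exists E : {linear trace_space n.-1 B -> W},
      continuous E /\ (forall f : trace_space n.-1 B, tr (E f) = f).
Proof.
(* Now [n = d.+2]: the boundary has dimension [d.+1], so there is a first axis to oscillate
   along. *)
case: n n_ge2 W B tr tr_continuous tr_extends => [//|[//|d]] _ W B tr trc trE.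
(* From here the order is [k.+1], and the last trace component is the normal derivative of order
   [k]. *)
case: k k_ge1 m m_gt W B tr trc trE => [//|k] _ m _ W B tr trc trE [E [Ec EK]].
have [C _ EC] := continuous_linear_le Ec.
have [D D0 trD] := continuous_linear_le trc.
pose top : L1 (lebesgue_rV R d.+1) -> trace_space d.+1 B :=
  @trace_top R d.+1 k.+1 B.
(* Linearity of [E] makes this interval function additive, boundedness makes it Lipschitz. *)
pose g a b : W := E (top (strip_indicator d a b)).
have gD a b c : a <= b -> b <= c -> g a b + g b c = g a c.
  move=> ab bc; rewrite /g -linearD -(strip_indicatorD d ab bc); congr (E _).
  by have := trace_top_linear B 1 (strip_indicator d a b) (strip_indicator d b c);
    rewrite !scale1r.
have gC a b : a <= b -> `|g a b| <= C * (b - a).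
  move=> ab; apply: le_trans (EC _) _.
  by rewrite norm_trace_top norm_strip_indicator.
(* Chosen so that [D * e + 6 * e = 1 / 2]: in [key], half of [T] is then absorbed by the left-hand
   side. *)
pose e := (2 * (D + 6))^-1.
have e0 : 0 < e by rewrite invr_gt0 mulr_gt0// addr_gt0.
have [q [T [q0 T0] small]] := uniformly_small_slab_mass gD gC e0.
(* The number [q * (2 * p)] of cells is even, so that the signs come in pairs; [q], [T] and [e] do
   not depend on [p]. *)
have key p : (0 < p)%N ->
    T <= T * (D * e + 6 * e) + 2 * (q * (2 * p))%:R^-1 * (6 * e).
  move=> p0; have p20 : (0 < 2 * p)%N by rewrite muln_gt0.
  have [u [cu ug us]] := small (2 * p)%N p20.
  set M := (q * (2 * p))%N in ug us *.
  have M0 : 0 < M%:R :> R by rewrite ltr0n muln_gt0 q0.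
  pose h : R := M%:R^-1; have h0 : 0 < h by rewrite invr_gt0.
  pose U x := \sum_(i < M) (-1) ^+ i * u i x.
  have cU : Cc_infty U by apply: (@Cc_infty_sum _ _ (fun i => (-1) ^+ i)) => i _.
  pose v := partials (nseq k ord_max) U.
  have sv : smooth v by apply: smooth_partials; exact: cU.1.
  pose w := sobolev_emb W U.
  pose r := sign_strips d h M.
  have Er : E (top r) = \sum_(i < M) (-1) ^+ i *: grid_val g M i.
    (* The number of terms is generalized for the induction, while the mesh [h] stays [1 / M]. *)
    suff : forall N, E (top (sign_strips d h N)) =
      \sum_(i < N) (-1) ^+ i *: g (i%:R * h) (i.+1%:R * h) by apply.
    rewrite /sign_strips; elim=> [|N ih].
      by rewrite !big_ord0; exact: linear0.
    rewrite [X in top X]big_ord_recr [RHS]big_ord_recr/= -ih.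
    rewrite [X in top X]addrC [RHS]addrC.
    by rewrite /top trace_top_linear linearP.
  have wr : `|w - E (top r)| <= e.
    rewrite Er /w /U.
    rewrite (@sobolev_emb_sum _ _ _ W (fun i => (-1) ^+ i) u M (fun i _ => cu i)).
    rewrite -sumrB; apply: le_trans ug; apply: le_trans (ler_norm_sum _ _ _) _.
    apply: ler_sum => i _; rewrite -scalerBr normrZ normrX normrN1 expr1n.
    by rewrite mul1r.
  (* Here the right inverse enters: [tr (E (top r)) = top r], so the last trace component of [w] is
     close to the oscillating datum. *)
  have trr : `|trace_L1 (tr w) - r| <= D * e.
    apply: le_trans (ler_wpM2l (ltW D0) wr); apply: le_trans (trD _).
    by rewrite linearB EK; exact: (norm_trace_L1_le (tr w - top r)).
  have vb : measurable_fun setT (fun x => v (@boundary R d.+2 x)).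
    apply: continuous_measurable_rV; apply: continuous_comp_boundary.
    exact: (sv [::]).1.
  have Phi : (\int[lebesgue_rV R d.+1]_(x in strip 0 1)
      `|sign_step h M (x 0 ord0) - v (@boundary R d.+2 x)|%:E <= (D * e)%:E)%E.
    have := trr; rewrite -lee_fin; apply: le_trans.
    apply: integral_sign_step_le => //.
    by have [_] := trE U cU; rewrite normal_traceE.
  have massU : sobolev_mass k.+1 (slab T) U <= 6 * e.
    apply: le_trans us.
    apply: le_trans (sobolev_mass_sum W (fun i => (-1) ^+ i) (measurable_slab T) _
      (fun i _ => cu i)) _; first by move=> z [].
    by apply: ler_sum => i _; rewrite normrX normrN1 expr1n mul1r.
  (* Both [partial ord_max v] and [partial ord0 v] are derivatives of [U] of order [k.+1], hence
     controlled by its mass in the layer. *)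
  have Psi (s : k.+1.-tuple 'I_d.+2) :
      (\int[lebesgue_rV R d.+2]_(z in slab T) `|partials s U z|%:E <= (6 * e)%:E)%E.
    have := massU; rewrite -lee_fin; apply: le_trans.
    by apply: (integral_partials_le W) => //; [exact: measurable_slab|move=> z []].
  have hp : 2 * h * (q * p)%:R = 1.
    by rewrite mulrAC -natrM mulnCA divff// gt_eqF.
  have := @boundary_oscillation R d (sign_step h M) v h T (q * p) h0 hp T0
    (measurable_sign_step h M).
  have -> : (2 * (q * p) = M)%N by rewrite mulnCA.
  move=> /(_ (fun i x => @sign_stepE R h M i x h0) sv) osc.
  rewrite -lee_fin; apply: (le_trans osc); rewrite EFinD [in leRHS]EFinM.
  apply: leeD.
    apply: lee_wpmul2l; first by rewrite lee_fin ltW.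
    rewrite EFinD; apply: leeD => //.
    exact: (Psi [tuple of ord_max :: nseq k ord_max]).
  rewrite [in leRHS]EFinM; apply: lee_wpmul2l.
    by rewrite lee_fin mulr_ge0// ltW.
  exact: (Psi [tuple of ord0 :: nseq k ord_max]).
have eD : D * e + 6 * e = 2^-1.
  by rewrite -mulrDl /e invfM mulrCA divff ?mulr1// gt_eqF// addr_gt0.
(* With [1 / p.+1 < T / (24 * e)] the last term of [key], at most [12 * e / p.+1], is less than
   [T / 2]. *)
have [p _ /(_ p (leqnn p)) /= pT] :=
  near_infty_natSinv_lt (PosNum (divr_gt0 T0 (mulr_gt0 (ltr0n R 24) e0))).
have := key p.+1 isT; rewrite eD.
have : (q * (2 * p.+1))%:R^-1 <= p.+1%:R^-1 :> R.
  rewrite lef_pV2 ?posrE ?ltr0n ?muln_gt0 ?q0// ler_nat mulnA.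
  by rewrite leq_pmull// muln_gt0 q0.
move: pT; rewrite ltr_pdivlMr ?mulr_gt0//.
set a := p.+1%:R^-1; set b := (q * _)%:R^-1 => ae ba Tb.
have := ler_wpM2r (ltW e0) ba; lra.
Qed.
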